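(* Let $\mu$ and $\nu$ be two finite positive measures supported in $\mathbb{C}$ which integrate the logarithm at infinity and satisfy $$(\operatorname{supp}\mu)\cup(\operatorname{supp}\nu)\neq\mathbb{C},$$ and let $\Omega\subset\mathbb{C}$ be a domain where $V^{\mu}$ and $V^{\nu}$ are finite and satisfy, for some constant $c$, $$V^{\mu}(z)\le V^{\nu}(z)+c,\qquad z\in\Omega.$$ Then, if $A\subset\Omega$ is the subset where equality holds, we have $\nu_{|A}\le\mu_{|A}$.
   Context: $V^{\sigma}(z)=-\int\log|z-t|\,d\sigma(t)$ is the logarithmic potential of a measure $\sigma$. A measure $\sigma$ on $\mathbb{C}$ integrates the logarithm at infinity if $\int\log(1+|t|)\,d\sigma(t)<\infty$. The supports of $\mu$ and $\nu$ may be unbounded. $\sigma_{|A}$ denotes the restriction of $\sigma$ to $A$. *)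

(* Defs.v *)
From HB Require Import structures.
From mathcomp Require Import all_boot all_order all_algebra.
From mathcomp Require Import complex.
From mathcomp Require Import all_classical all_reals all_analysis.

Set Implicit Arguments.
Unset Strict Implicit.
Unset Printing Implicit Defensive.

Import Order.TTheory GRing.Theory Num.Theory.
Import numFieldNormedType.Exports.

Local Open Scope classical_set_scope.
Local Open Scope ring_scope.

(* The topology of the complex numbers R[i] is the one carried by the
   convertible type R[i]^o; measures are Borel measures for that topology. *)
Definition borelC (R : realType) := g_sigma_algebraType (@open (R[i]^o)).

Section Potential.
Context {R : realType}.
Implicit Types sigma : {finite_measure set (borelC R) -> \bar R}.

Definition modulus (z : R[i]) : R := Normc.normc z.

(* [ln 0 = 0] in the library, so the logarithm must be [lne], for which
   [lne 0 = -oo]: a point mass at z makes the potential +oo at z. *)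
Definition log_potential sigma (z : R[i]) : \bar R :=
  (- \int[sigma]_(t in [set: borelC R]) lne (modulus (z - (t : R[i])))%:E)%E.

Definition integrates_log_at_infinity sigma : Prop :=
  (\int[sigma]_(t in [set: borelC R]) (ln (1 + modulus (t : R[i])))%:E < +oo)%E.

Definition measure_support sigma : set R[i]^o :=
  [set z | forall U : set R[i]^o, open U -> U z -> (0 < sigma U)%E].

Definition domain (Omega : set R[i]^o) : Prop :=
  [/\ open Omega, connected Omega & Omega !=set0].

End Potential.

(* Main.v *)
Require Import Defs.
From HB Require Import structures.
From mathcomp Require Import all_boot all_order all_algebra.
From mathcomp Require Import complex.
From mathcomp Require Import all_classical all_reals all_analysis.
From mathcomp Require Import measurable_realfun.
From mathcomp Require Import ring lra zify.

Set Implicit Arguments.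
Unset Strict Implicit.
Unset Printing Implicit Defensive.

Import Order.TTheory GRing.Theory Num.Theory.
Import numFieldNormedType.Exports.

Local Open Scope classical_set_scope.
Local Open Scope ring_scope.
Local Open Scope ereal_scope.


(** The proof replaces fine potential theory by a second order argument on
regularized potentials. Put w = V^mu - V^nu - c, so that w <= 0 on Omega and the
contact set A is the zero set of w in Omega. Formally, for k > 0, the function
exp(k w) satisfies Laplacian(exp(k w)) >= k exp(k w) Laplacian(w), and
Laplacian(w) = 2 pi (nu - mu). Integrating against a test function chi >= 0
supported in Omega, where exp(k w) <= 1, gives
  int chi exp(k w) dnu <= int chi exp(k w) dmu + C(chi) / k,
and as k tends to infinity exp(k w) decreases to the indicator function of A in
Omega, whence int_A chi dnu <= int_A chi dmu. Letting chi tend to the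
indicator function of an open set U contained in Omega gives
nu(A & U) <= mu(A & U) ([contact_le_open]), and outer regularity of mu passes
from open sets to Borel sets ([contact_le]).

To make the formal step rigorous, the logarithm is truncated at radius r
([log_kernel]) and the Laplacian is replaced by the difference between the mean
over a circle of radius 2 r and the value. By the formula for the circle means of
log|a + z| ([log_circleE]), the truncated kernel falls short of its mean by a
nonnegative bump supported in the disc of radius 3 r ([deficit]); normalized by
its integral, this bump is an approximate identity. The truncated potential is
the mean of the potential over a circle of radius r ([potential_circle_mean]), so
the inequality w <= 0 survives the regularization away from the boundary of Omega
([reg_potential_le]). Convexity of the exponential gives the inequality for
exp(k w) ([exp_reg_potential_mean]). By Tonelli the circle mean is then moved onto
chi ([mean_transfer]), which only has to satisfy the one-sided bound
mean(chi) <= chi + C r^2; infima of quadratic functions do ([cutoff_circle_mean]),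
so that no smooth function is involved. Finally the truncated potentials converge
at each point where the potential is finite, uniformly over points at distance
O(r) ([reg_potential_cvg]), which identifies the limit as r tends to 0. *)


(** * Modulus and Borel sets of the complex plane *)

Arguments modulus {R} z%_ring_scope.

Section Modulus.
Context {R : realType}.
Implicit Types z w : R[i].
Local Open Scope ring_scope.

Lemma modulusE z :
  modulus z = Num.sqrt (complex.Re z ^+ 2 + complex.Im z ^+ 2).
Proof. by case: z. Qed.

Lemma modulus_normE z : `|z| = (modulus z)%:C%C.
Proof. by []. Qed.

Lemma modulus_ge0 z : 0 <= modulus z.
Proof. by rewrite modulusE sqrtr_ge0. Qed.

Lemma sqr_modulus z : modulus z ^+ 2 = complex.Re z ^+ 2 + complex.Im z ^+ 2.
Proof. by rewrite modulusE sqr_sqrtr// addr_ge0// sqr_ge0. Qed.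

Lemma modulusD z w : modulus (z + w) <= modulus z + modulus w.
Proof. by have := ler_normD z w; rewrite !modulus_normE -rmorphD lecR. Qed.

Lemma modulusN z : modulus (- z) = modulus z.
Proof. by have := normrN z; rewrite !modulus_normE => /complexI. Qed.

Lemma modulusB z w : modulus (z - w) = modulus (w - z).
Proof. by rewrite -opprB modulusN. Qed.

Lemma modulusM z w : modulus (z * w) = modulus z * modulus w.
Proof. exact: Normc.normcM. Qed.

Lemma modulusX z n : modulus (z ^+ n) = modulus z ^+ n.
Proof.
elim: n => [|n ih]; first by rewrite !expr0; exact: Normc.normc1.
by rewrite !exprS modulusM ih.
Qed.

Lemma modulus_eq0 z : (modulus z == 0) = (z == 0).
Proof.
apply/eqP/eqP => [/Normc.eq0_normc//|->]; exact: Normc.normc0.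
Qed.

Lemma modulus0 : modulus (0 : R[i]) = 0.
Proof. exact: Normc.normc0. Qed.

Lemma modulusC (r : R) : modulus r%:C%C = `|r|.
Proof. by rewrite modulusE /= expr0n addr0 sqrtr_sqr. Qed.

Lemma modulus_conj z : modulus (conjc z) = modulus z.
Proof. by rewrite !modulusE; case: z => a b /=; rewrite sqrrN. Qed.

Lemma modulus_triangle u z w : modulus (z - w) <= modulus (z - u) + modulus (u - w).
Proof. by rewrite -[z - w](subrKA u) modulusD. Qed.

Lemma le_modulusB z w : modulus z - modulus w <= modulus (z - w).
Proof. by have := modulusD (z - w) w; rewrite subrK lerBlDr. Qed.

Lemma Re_le_modulus z : `|complex.Re z| <= modulus z.
Proof.
by rewrite modulusE -sqrtr_sqr ler_sqrt ?addr_ge0 ?sqr_ge0// lerDl sqr_ge0.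
Qed.

Lemma Im_le_modulus z : `|complex.Im z| <= modulus z.
Proof.
by rewrite modulusE -sqrtr_sqr ler_sqrt ?addr_ge0 ?sqr_ge0// lerDr sqr_ge0.
Qed.

Lemma modulus_le_ReIm z : modulus z <= `|complex.Re z| + `|complex.Im z|.
Proof.
rewrite -(@ler_pXn2r _ 2)// ?nnegrE ?modulus_ge0 ?addr_ge0// sqr_modulus.
by rewrite sqrrD !real_normK ?num_real// -addrAC lerDl mulrn_wge0// mulr_ge0.
Qed.

Lemma ReB z w : complex.Re (z - w) = complex.Re z - complex.Re w.
Proof. by case: z w => a b [c d]. Qed.

Lemma ImB z w : complex.Im (z - w) = complex.Im z - complex.Im w.
Proof. by case: z w => a b [c d]. Qed.

Lemma ReD z w : complex.Re (z + w) = complex.Re z + complex.Re w.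
Proof. by case: z w => a b [c d]. Qed.

Lemma ImD z w : complex.Im (z + w) = complex.Im z + complex.Im w.
Proof. by case: z w => a b [c d]. Qed.

Lemma ReCM (r : R) z : complex.Re (r%:C%C * z) = r * complex.Re z.
Proof. by case: z => a b /=; rewrite mul0r subr0. Qed.

Lemma ImCM (r : R) z : complex.Im (r%:C%C * z) = r * complex.Im z.
Proof. by case: z => a b /=; rewrite mul0r addr0. Qed.

Lemma open_modulusP (U : set R[i]^o) : open U <->
  forall z, U z -> exists2 d : R, 0 < d &
    forall w, modulus (z - w) < d -> U w.
Proof.
split=> [oU z Uz|UP].
  have := open_nbhs_nbhs (conj oU Uz); rewrite -nbhs_ballE => -[e /= e0 Be].
  have eE : e = (complex.Re e)%:C%C.
    by case: e e0 {Be} => a b; rewrite ltcE /= => /andP[/eqP -> _].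
  have Re0 : 0 < complex.Re e by rewrite eE ltcR in e0.
  exists (complex.Re e) => // w zw; apply: Be.
  by rewrite /ball /= modulus_normE eE ltcR.
rewrite openE => z Uz; have [d d0 dU] := UP z Uz.
apply/nbhs_ballP; exists d%:C%C => /=; first by rewrite ltcR.
by move=> w; rewrite /ball /= modulus_normE ltcR; exact: dU.
Qed.

Lemma open_disc (a : R[i]) (r : R) : open ([set z | modulus (a - z) < r] : set R[i]^o).
Proof.
apply/open_modulusP => z /= az; exists (r - modulus (a - z)); first by rewrite subr_gt0.
move=> w; rewrite ltrBrDl => zw; apply: le_lt_trans zw.
exact: modulus_triangle.
Qed.

End Modulus.

Section BorelC.
Context {R : realType}.
Implicit Types z w : R[i].
Local Open Scope ring_scope.

Lemma open_measurableC (U : set R[i]^o) : open U -> measurable (U : set (borelC R)).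
Proof. exact: sub_sigma_algebra. Qed.

(** Preimages of open rays are open as soon as the function is lower
semicontinuous, which the Lipschitz bound gives. *)
Lemma lipschitz_measurable (f : borelC R -> R) (k : R) :
  (forall z w : R[i], `|f z - f w| <= k * modulus (z - w)) ->
  measurable_fun setT f.
Proof.
move=> fk; apply: (measurability _ (RGenOInfty.measurableE R)) => _ [_ [x ->] <-].
rewrite setTI; apply: open_measurableC; apply/open_modulusP => z /=.
rewrite in_itv/= andbT => xz.
have k1 : 0 < `|k| + 1 by rewrite ltr_pwDr.
exists ((f z - x) / (`|k| + 1)); first by rewrite divr_gt0// subr_gt0.
move=> w; rewrite ltr_pdivlMr// => zw; rewrite in_itv/= andbT.
have := fk z w; rewrite ler_norml => /andP[_ H].
have H2 : k * modulus (z - w) <= (`|k| + 1) * modulus (z - w).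
  rewrite ler_wpM2r ?modulus_ge0//.
  by rewrite (le_trans (ler_norm k))// lerDl.
by lra.
Qed.

Lemma measurable_Re : measurable_fun setT (fun z : borelC R => complex.Re (z : R[i])).
Proof.
apply: (@lipschitz_measurable _ 1) => z w.
by rewrite mul1r -ReB Re_le_modulus.
Qed.

Lemma measurable_Im : measurable_fun setT (fun z : borelC R => complex.Im (z : R[i])).
Proof.
apply: (@lipschitz_measurable _ 1) => z w.
by rewrite mul1r -ImB Im_le_modulus.
Qed.

Lemma measurable_modulus : measurable_fun setT (fun z : borelC R => modulus (z : R[i])).
Proof.
apply: (@lipschitz_measurable _ 1) => z w.
rewrite mul1r ler_norml le_modulusB andbT lerNl opprB modulusB.
exact: le_modulusB.
Qed.

(** An open set of the plane is the union of the rational squares that it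
contains, so that a map into the plane is measurable when both of its real
coordinates are. *)
Lemma measurable_ReIm d (T : measurableType d) (f : T -> borelC R) :
  measurable_fun setT (fun x => complex.Re (f x : R[i])) ->
  measurable_fun setT (fun x => complex.Im (f x : R[i])) ->
  measurable_fun setT f.
Proof.
move=> mRe mIm.
apply: (@measurability _ _ T (borelC R) setT f (@open R[i]^o) erefl) => _ [U oU <-]; rewrite setTI.
pose I (a q : rat) : interval R := `](ratr a - ratr q), (ratr a + ratr q)[.
pose Q (p : rat * rat * rat) : set R[i] := [set z |
  complex.Re z \in I p.1.1 p.2 /\ complex.Im z \in I p.1.2 p.2].
have -> : f @^-1` U = \bigcup_(p in [set p | Q p `<=` U]) (f @^-1` Q p).
  apply/seteqP; split => [x /= Ux|x [p /= pU]]; last exact: pU.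
  have [d' d0 dU] := (open_modulusP U).1 oU _ Ux.
  have [q] : exists q : rat, ratr q \in `](d' / 8), (d' / 4)[.
    by apply: rat_in_itvoo; lra.
  rewrite in_itv/= => /andP[q1 q2].
  have [a] : exists a : rat, ratr a \in `](complex.Re (f x : R[i]) - d' / 8),
      (complex.Re (f x : R[i]) + d' / 8)[.
    by apply: rat_in_itvoo; lra.
  rewrite in_itv/= => /andP[a1 a2].
  have [b] : exists b : rat, ratr b \in `](complex.Im (f x : R[i]) - d' / 8),
      (complex.Im (f x : R[i]) + d' / 8)[.
    by apply: rat_in_itvoo; lra.
  rewrite in_itv/= => /andP[b1 b2].
  exists (a, b, q); last by split; rewrite in_itv/=; apply/andP; split; lra.
  move=> z [/=]; rewrite !in_itv/= => /andP[z1 z2] /andP[z3 z4].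
  apply: dU; apply: le_lt_trans (modulus_le_ReIm _) _.
  rewrite ReB ImB; set u := complex.Re (f x : R[i]) in a1 a2 *.
  set v := complex.Im (f x : R[i]) in b1 b2 *.
  have : `|u - complex.Re z| < d' / 2 by rewrite ltr_norml; apply/andP; split; lra.
  have : `|v - complex.Im z| < d' / 2 by rewrite ltr_norml; apply/andP; split; lra.
  by lra.
rewrite bigcup_mkcond; apply: countable_bigcupT_measurable => // p.
case: ifPn => // _; apply: measurableI.
- by rewrite -[X in measurable X]setTI; exact: (mRe measurableT _ (measurable_itv (I p.1.1 p.2))).
- by rewrite -[X in measurable X]setTI; exact: (mIm measurableT _ (measurable_itv (I p.1.2 p.2))).
Qed.

End BorelC.

(** * Integration over the circle *)

Section AffineSubstitution.
Context {R : realType}.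
Let lambda := @lebesgue_measure R.

Lemma lebesgue_measure_affine (c d : R) (A : set (measurableTypeR R)) :
  (0 < c)%R -> measurable A ->
  lambda A = c%:E * lambda ((fun x : R => c * x + d)%R @^-1` A).
Proof.
move=> c0 mA.
have mphi : measurable_fun setT
    ((fun x => c * x + d)%R : measurableTypeR R -> measurableTypeR R).
  by apply: measurable_funD => //; exact: measurable_funM.
pose nu := mscale (NngNum (ltW c0))
  (pushforward lambda ((fun x => c * x + d)%R : measurableTypeR R -> measurableTypeR R)).
suff : lambda A = nu mphi A by [].
apply: lebesgue_measure_unique => // _ [[a b] /= _ <-].
change (lambda `]a, b]%classic =
  c%:E * lambda ((fun x : R => (c * x + d)%R) @^-1` `]a, b]%classic)).
rewrite [X in _ = _ * _ X](_ : _ = `]((a - d) / c)%R, ((b - d) / c)%R]%classic); last first.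
  apply/seteqP; split => x /=; rewrite !in_itv/= ltr_pdivrMr// ler_pdivlMr//;
  by rewrite ltrBlDr lerBrDr mulrC.
rewrite /lambda !lebesgue_measure_itv/= !lte_fin; rewrite ltr_pM2r ?invr_gt0// ltrD2r.
case: ifPn => ab; last by rewrite mule0.
by rewrite -!EFinB -EFinM -mulrBl mulrCA divff ?gt_eqF// mulr1 opprB addrA subrK.
Qed.

Lemma integral_affine (c d : R) (D : set (measurableTypeR R)) (f : R -> \bar R) :
  (0 < c)%R -> measurable D -> measurable_fun setT f -> (forall x, 0 <= f x) ->
  \int[lambda]_(x in D) f x =
  c%:E * \int[lambda]_(x in (fun x : R => c * x + d)%R @^-1` D) f (c * x + d)%R.
Proof.
move=> c0 mD mf f0.
have mphi : measurable_fun setT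
    ((fun x => c * x + d)%R : measurableTypeR R -> measurableTypeR R).
  by apply: measurable_funD => //; exact: measurable_funM.
pose nu := mscale (NngNum (ltW c0))
  (pushforward lambda ((fun x => c * x + d)%R : measurableTypeR R -> measurableTypeR R)).
transitivity (\int[nu mphi]_(x in D) f x).
  apply: eq_measure_integral => //= A mA _.
  exact: (@lebesgue_measure_affine c d).
rewrite ge0_integral_mscale//=; last exact: measurable_funTS.
by rewrite ge0_integral_pushforward//; exact: measurable_funTS.
Qed.

End AffineSubstitution.

Section Circle.
Context {R : realType}.
Let lambda := @lebesgue_measure R.

Lemma pi2_gt0 : (0 < pi *+ 2 :> R)%R.
Proof. by rewrite pmulrn_lgt0// pi_gt0. Qed.

Definition circle_prob : probability (measurableTypeR R) R := uniform_prob pi2_gt0.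

Definition unit_circle (x : R) : R[i] := (cos x +i* sin x)%C.

Lemma modulus_circle x : modulus (unit_circle x) = 1%R.
Proof. by rewrite modulusE /= cos2Dsin2 sqrtr1. Qed.

Lemma unit_circleD2pi x : unit_circle (x + pi *+ 2) = unit_circle x.
Proof. by rewrite /unit_circle cosD2pi sinD2pi. Qed.

Lemma unit_circleDpi x : unit_circle (x + pi) = (- unit_circle x)%R.
Proof. by rewrite /unit_circle cosDpi sinDpi. Qed.

Lemma unit_circle_sqr x : (unit_circle x ^+ 2)%R = unit_circle (x *+ 2).
Proof.
rewrite expr2 /unit_circle sin_mulr2n cos_mulr2n /GRing.mul/=.
congr (_ +i* _)%C; last by rewrite mulr2n [X in (_ + X)%R]mulrC.
by have := cos2Dsin2 x; lra.
Qed.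

Lemma measurable_unit_circle :
  measurable_fun setT (unit_circle : measurableTypeR R -> borelC R).
Proof.
apply: measurable_ReIm => /=; apply: continuous_measurable_fun.
- exact: continuous_cos.
- exact: continuous_sin.
Qed.

Lemma circle_integral_setIcc (f : R -> \bar R) :
  measurable_fun setT f -> (forall x, 0 <= f x) ->
  \int[circle_prob]_x f x =
  (pi *+ 2)^-1%:E * \int[lambda]_(x in `[0%R, (pi *+ 2)%R]) f x.
Proof. by move=> mf f0; rewrite integral_uniform// subr0. Qed.

Lemma integral_itv_split (f : R -> \bar R) (a b c : R) :
  measurable_fun setT f -> (forall x, 0 <= f x) -> (a <= b <= c)%R ->
  \int[lambda]_(x in `[a, c]) f x =
  \int[lambda]_(x in `[a, b]) f x + \int[lambda]_(x in `[b, c]) f x.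
Proof.
move=> mf f0 /andP[ab bc].
rewrite -(@integral_itv_obnd_cbnd _ b)//; last exact: measurable_funTS.
rewrite -ge0_integral_setU//=.
- rewrite -itv_bndbnd_setU//= ?bnd_simp//.
- exact: measurable_funTS.
- rewrite disj_set2E; apply/eqP; rewrite -subset0 => x [] /=.
  by rewrite !in_itv/= => /andP[_ xb] /andP[]; rewrite ltNge xb.
Qed.

Lemma affine_preimage_itv (c d a b : R) : (0 < c)%R ->
  (fun x : R => c * x + d)%R @^-1` `[(c * a + d)%R, (c * b + d)%R] = `[a, b]%classic.
Proof.
by move=> c0; apply/seteqP; split => x /=; rewrite !in_itv/= !lerD2r !ler_pM2l.
Qed.

Lemma integral_itv_shift (f : R -> \bar R) (a b d : R) :
  measurable_fun setT f -> (forall x, 0 <= f x) ->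
  \int[lambda]_(x in `[a, b]) f (x + d)%R =
  \int[lambda]_(x in `[(a + d)%R, (b + d)%R]) f x.
Proof.
move=> mf f0.
have := @integral_affine R 1 d `[(a + d)%R, (b + d)%R]%classic f ltr01
  (measurable_itv _) mf f0.
rewrite mul1e => ->.
rewrite -{1}[in `[(a + d)%R, _]](mul1r a) -{1}[in `[_, (b + d)%R]](mul1r b).
rewrite (@affine_preimage_itv 1 d a b)//.
by apply: eq_integral => x _; rewrite mul1r.
Qed.

(** Cut [0, 2 pi] at pi: the half turn exchanges the two halves up to a period. *)
Lemma circle_half_turn (f : R -> \bar R) :
  measurable_fun setT f -> (forall x, 0 <= f x) ->
  (forall x, f (x + pi *+ 2)%R = f x) ->
  \int[circle_prob]_x f (x + pi)%R = \int[circle_prob]_x f x.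
Proof.
move=> mf f0 fper; have pi0 : (0 <= pi :> R)%R by rewrite ltW// pi_gt0.
have mfpi : measurable_fun setT (fun x : R => f (x + pi)%R).
  by apply: measurableT_comp => //; exact: measurable_funD.
rewrite !circle_integral_setIcc//; congr (_ * _).
rewrite (@integral_itv_shift f 0 (pi *+ 2) pi mf f0).
rewrite (@integral_itv_split f _ (pi *+ 2)%R _ mf f0); last first.
  by rewrite add0r mulr2n lerDl pi0 /= lerDl.
rewrite (@integral_itv_split f 0%R pi (pi *+ 2)%R mf f0); last first.
  by rewrite pi0 mulr2n lerDl.
rewrite addeC add0r; congr (_ + _).
have := @integral_itv_shift f 0 pi (pi *+ 2) mf f0.
rewrite add0r [(pi + _)%R]addrC => <-.
by apply: eq_integral => x _; rewrite fper.
Qed.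

(** In C this is the substitution z -> z^2, which winds twice around the circle. *)
Lemma circle_double (f : R -> \bar R) :
  measurable_fun setT f -> (forall x, 0 <= f x) ->
  (forall x, f (x + pi *+ 2)%R = f x) ->
  \int[circle_prob]_x f (x *+ 2)%R = \int[circle_prob]_x f x.
Proof.
move=> mf f0 fper; have pi0 : (0 <= pi :> R)%R by rewrite ltW// pi_gt0.
have mf2 : measurable_fun setT (fun x : R => f (x *+ 2)%R).
  by apply: measurableT_comp => //; exact: measurable_funD.
rewrite !circle_integral_setIcc//; congr (_ * _).
have /= := @integral_affine R 2 0 `[0%R, (pi *+ 2 *+ 2)%R]%classic f (ltr0n R 2)
  (measurable_itv _) mf f0.
have -> : (fun x : R => 2 * x + 0)%R @^-1` `[0%R, (pi *+ 2 *+ 2)%R] =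
    `[0%R, (pi *+ 2)%R]%classic.
  rewrite -(@affine_preimage_itv 2 0 0 (pi *+ 2))//.
  by rewrite !addr0 mulr0 mulr_natl.
rewrite (@integral_itv_split _ _ (pi *+ 2)%R)//; last first.
  by rewrite pmulrn_lge0// pi0 /= [(_ *+ 2 *+ 2)%R]mulr2n lerDl pmulrn_lge0.
have -> : \int[lambda]_(x in `[(pi *+ 2)%R, (pi *+ 2 *+ 2)%R]) f x =
    \int[lambda]_(x in `[0%R, (pi *+ 2)%R]) f x.
  have := @integral_itv_shift f 0 (pi *+ 2) (pi *+ 2) mf f0.
  rewrite add0r -mulr2n => <-.
  by apply: eq_integral => x _; rewrite fper.
have -> : \int[lambda]_(x in `[0%R, (pi *+ 2)%R]) f (2 * x + 0)%R =
   \int[lambda]_(x in `[0%R, (pi *+ 2)%R]) f (x *+ 2)%R.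
  by apply: eq_integral => x _; rewrite addr0 mulr_natl.
set I := \int[lambda]_(x in _) _; set J := \int[lambda]_(x in _) _.
have -> : I + I = 2%:E * I by rewrite -[I in I + I]mul1e -ge0_muleDl.
by move/(congr1 (fun z => 2^-1%:E * z)); rewrite !muleA -!EFinM mulVf// !mul1e.
Qed.

End Circle.

(** * Circle means of the logarithm *)

Section CircleLog.
Context {R : realType}.

Lemma lne_ge_expR (r H : R) : (r <= expR H)%R -> lne r%:E <= H%:E.
Proof.
move=> rH; have [r0|r0] := leP r 0%R; first by rewrite le0_lneNy ?lee_fin// leNye.
by rewrite lne_EFin// lee_fin -ler_expR lnK.
Qed.

Lemma measurable_lne d (T : measurableType d) (f : T -> R) :
  measurable_fun setT f -> measurable_fun setT (fun x => lne (f x)%:E).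
Proof.
move=> mf.
have -> : (fun x => lne (f x)%:E) =
    (fun x => if (f x <= 0)%R then -oo else (ln (f x))%:E).
  apply/funext => x; case: ifPn => fx; first by rewrite le0_lneNy.
  by rewrite lne_EFin// ltNge.
apply: measurable_fun_ifT => //; first exact: measurable_fun_ler.
by apply/measurable_EFinP; apply: measurableT_comp.
Qed.

Lemma measurable_shifted_circle (a : R[i]) (r : R) :
  measurable_fun setT (fun x : R => modulus (a + r%:C%C * unit_circle x)).
Proof.
apply: (measurableT_comp measurable_modulus).
apply: measurable_ReIm.
- apply: (@eq_measurable_fun _ _ _ _ _ (fun x : R => complex.Re a + r * cos x)%R).
    by move=> x _; case: a => u v /=; rewrite mul0r subr0.
  apply: measurable_funD => //; apply: measurable_funM => //.
  apply: continuous_measurable_fun; exact: continuous_cos.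
- apply: (@eq_measurable_fun _ _ _ _ _ (fun x : R => complex.Im a + r * sin x)%R).
    by move=> x _; case: a => u v /=; rewrite mul0r addr0.
  apply: measurable_funD => //; apply: measurable_funM => //.
  apply: continuous_measurable_fun; exact: continuous_sin.
Qed.

Lemma modulus_shifted_circle_le (a : R[i]) (r x : R) : (0 <= r)%R ->
  (modulus (a + r%:C%C * unit_circle x) <= modulus a + r)%R.
Proof.
move=> r0; apply: le_trans (modulusD _ _) _.
by rewrite modulusM modulusC modulus_circle mulr1 ger0_norm.
Qed.

Lemma circle_integral_cst (k : \bar R) : \int[@circle_prob R]_x k = k.
Proof.
rewrite (integral_cst circle_prob measurableT k).
by rewrite [X in _ * X](@probability_setT _ _ _ circle_prob) mule1.
Qed.

(** The mean of log|a + r e| over the unit circle, up to sign and to the constant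
H, which is chosen large enough for the integrand to be nonnegative. *)
Definition log_circle (H : R) (a : R[i]) (r : R) : \bar R :=
  \int[@circle_prob R]_x (H%:E - lne (modulus (a + r%:C%C * unit_circle x))%:E).

Lemma log_circle_integrand_ge0 (H : R) (a : R[i]) (r x : R) : (0 <= r)%R ->
  (modulus a + r <= expR H)%R ->
  0 <= H%:E - lne (modulus (a + r%:C%C * unit_circle x))%:E.
Proof.
move=> r0 arH; rewrite sube_ge0 ?orbT//; apply: lne_ge_expR.
by apply: le_trans arH; exact: modulus_shifted_circle_le.
Qed.

Lemma measurable_log_circle (H : R) (a : R[i]) (r : R) :
  measurable_fun setT
    (fun x : R => H%:E - lne (modulus (a + r%:C%C * unit_circle x))%:E).
Proof.
apply: emeasurable_funB => //; apply: measurable_lne.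
exact: measurable_shifted_circle.
Qed.

Lemma log_circle_shift (H K : R) (a : R[i]) (r : R) : (0 <= r)%R -> (0 <= K)%R ->
  (modulus a + r <= expR H)%R ->
  log_circle (K + H) a r = K%:E + log_circle H a r.
Proof.
move=> r0 K0 arH; rewrite /log_circle.
rewrite -[in RHS](circle_integral_cst K%:E) -ge0_integralD//=.
- by apply: eq_integral => x _; rewrite addeA.
- by move=> x _; exact: log_circle_integrand_ge0.
- exact: measurable_log_circle.
Qed.

(** Since |e| = 1, this exchanges the roles of a and of 1, and so reduces a point
outside the unit disc to its inverse. *)
Lemma modulus_conjD (a : R[i]) (x : R) :
  modulus (a + unit_circle x) = modulus (conjc a * unit_circle x + 1).
Proof.
have -> : (conjc a * unit_circle x + 1)%R =
    (unit_circle x * conjc (a + unit_circle x))%R.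
  have := cos2Dsin2 x; case: a => u v h; rewrite /unit_circle.
  apply/eqP; rewrite eq_complex; apply/andP; split; apply/eqP => /=; rewrite /=; lra.
by rewrite modulusM modulus_circle mul1r modulus_conj.
Qed.

(** The logarithm is multiplicative and the half turn and the squaring preserve
the uniform law, so twice the mean of log|a + e| is the mean of log|-a^2 + e|. *)
Lemma log_circle_sqr (a : R[i]) : (modulus a <= 1)%R ->
  log_circle (ln 2) a 1 + log_circle (ln 2) a 1 =
  (ln 2)%:E + log_circle (ln 2) (- a ^+ 2)%R 1.
Proof.
move=> a1; have e2 : (1 + 1 <= expR (ln 2) :> R)%R by rewrite lnK ?posrE.
pose f (b : R[i]) (x : R) : \bar R :=
  (ln 2)%:E - lne (modulus (b + (1 : R)%:C%C * unit_circle x))%:E.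
have mf b : measurable_fun setT (f b) by exact: measurable_log_circle.
have f0 b x : (modulus b <= 1)%R -> 0 <= f b x.
  move=> b1; apply: log_circle_integrand_ge0 => //.
  by apply: le_trans e2; rewrite lerD2r.
have fper b x : f b (x + pi *+ 2)%R = f b x by rewrite /f unit_circleD2pi.
have a21 : (modulus (- a ^+ 2) <= 1)%R.
  by rewrite modulusN modulusX exprn_ile1// modulus_ge0.
have step x : f a x + f a (x + pi)%R = (ln 2)%:E + f (- a ^+ 2)%R (x *+ 2)%R.
  rewrite /f !mul1r unit_circleDpi -unit_circle_sqr.
  have -> : modulus (- a ^+ 2 + unit_circle x ^+ 2) =
      (modulus (a + unit_circle x) * modulus (a - unit_circle x))%R.
    by rewrite -modulusM -modulusN; congr modulus; ring.
  set p := modulus _; set q := modulus _.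
  have p0 : (0 <= p)%R by exact: modulus_ge0.
  have q0 : (0 <= q)%R by exact: modulus_ge0.
  have [->|pn0] := eqVneq p 0%R.
    by rewrite mul0r /lne lexx; case: ifP.
  have [->|qn0] := eqVneq q 0%R.
    by rewrite mulr0 /lne lexx; case: ifP.
  have pp : (0 < p)%R by rewrite lt_neqAle eq_sym pn0.
  have qp : (0 < q)%R by rewrite lt_neqAle eq_sym qn0.
  rewrite !lne_EFin ?mulr_gt0// lnM ?posrE//.
  by rewrite -!EFinB -!EFinD; congr EFin; ring.
have -> : log_circle (ln 2) a 1 + log_circle (ln 2) a 1 =
    \int[@circle_prob R]_x (f a x + f a (x + pi)%R).
  rewrite ge0_integralD//.
  - by rewrite (@circle_half_turn _ (f a))// => x; exact: f0.
  - by move=> x _; exact: f0.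
  - exact: mf.
  - by move=> x _; exact: f0.
  - by apply: (measurableT_comp (mf a)); exact: measurable_funD.
under eq_integral do rewrite step.
rewrite ge0_integralD//.
- rewrite circle_integral_cst (@circle_double _ (f (- a ^+ 2)%R))//.
  by move=> x; exact: f0.
- by move=> x _; rewrite lee_fin ln_ge0// ler1n.
- by move=> x _; exact: f0.
- by apply: (measurableT_comp (mf (- a ^+ 2)%R)); exact: measurable_funD.
Qed.

End CircleLog.

Section CircleLogValue.
Context {R : realType}.

Lemma log_circle_le (a : R[i]) (c : R) : (modulus a <= c < 1)%R ->
  log_circle (ln 2) a 1 <= (ln 2 - ln (1 - c))%:E.
Proof.
move=> /andP[ac c1]; rewrite -(circle_integral_cst (ln 2 - ln (1 - c))%:E).
have a1 : (modulus a + 1 <= expR (ln 2))%R.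
  by rewrite lnK ?posrE//; move: ac c1; lra.
apply: ge0_le_integral => //.
- by move=> x _; exact: log_circle_integrand_ge0.
- exact: measurable_log_circle.
- move=> x _; rewrite mul1r.
  have cx : (1 - c <= modulus (a + unit_circle x))%R.
    have := le_modulusB (unit_circle x) (- a)%R; rewrite modulus_circle modulusN.
    by rewrite opprK [(unit_circle x + a)%R]addrC; lra.
  have c0 : (0 < 1 - c)%R by rewrite subr_gt0.
  rewrite lne_EFin ?(lt_le_trans c0)// -EFinB lee_fin lerD2l lerN2.
  by rewrite ler_ln ?posrE// (lt_le_trans c0).
Qed.

(** By [log_circle_sqr] the distance of the mean to its expected value doubles when
a is replaced by - a^2, but it stays bounded on the disc of radius |a|: it is 0. *)
Lemma log_circle_lt1 (a : R[i]) : (modulus a < 1)%R ->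
  log_circle (ln 2) a 1 = (ln 2)%:E.
Proof.
move=> a1.
pose J (b : R[i]) : R := fine (log_circle (ln 2) b 1).
have e2 : (1 + 1 <= expR (ln 2) :> R)%R by rewrite lnK ?posrE.
have J0 (b : R[i]) : (modulus b <= modulus a)%R -> 0 <= log_circle (ln 2) b 1.
  move=> ba; apply: integral_ge0 => x _; apply: log_circle_integrand_ge0 => //.
  by apply: le_trans e2; rewrite lerD2r (le_trans ba)// ltW.
have JE (b : R[i]) : (modulus b <= modulus a)%R -> log_circle (ln 2) b 1 = (J b)%:E.
  move=> ba; rewrite fineK// ge0_fin_numE ?J0//.
  by apply: le_lt_trans (@log_circle_le b (modulus a) _) (ltry _); rewrite ba.
pose M := (ln 2 - ln (1 - modulus a))%R.
have ln20 : (0 <= ln 2 :> R)%R by rewrite ln_ge0// ler1n.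
have lna : (ln (1 - modulus a) <= 0)%R by rewrite ln_le0// gerBl modulus_ge0.
have JM n : forall b : R[i], (modulus b <= modulus a)%R ->
    (`|J b - ln 2| * 2 ^+ n <= M)%R.
  elim: n => [|n ih] b ba.
    have := J0 b ba; rewrite JE// lee_fin => Jb0.
    have : log_circle (ln 2) b 1 <= M%:E by apply: log_circle_le; rewrite ba.
    rewrite JE// lee_fin => JbM.
    by rewrite expr0 mulr1 ler_norml /M in JbM *; apply/andP; split; lra.
  have b1 : (modulus b <= 1)%R by rewrite (le_trans ba)// ltW.
  have b2 : (modulus (- b ^+ 2) <= modulus a)%R.
    rewrite modulusN modulusX (le_trans _ ba)// expr2.
    by rewrite ler_piMl// modulus_ge0.
  have := log_circle_sqr b1; rewrite !JE// -!EFinD => -[Jb].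
  have := ih _ b2.
  have -> : (J (- b ^+ 2) - ln 2 = (J b - ln 2) * 2)%R by lra.
  by rewrite normrM [`|2|%R]ger0_norm// -mulrA -exprS.
rewrite JE//; congr EFin; apply/eqP; rewrite -subr_eq0 -normr_eq0.
apply: contraT => Ja; have {}Ja : (0 < `|J a - ln 2|)%R by rewrite lt_neqAle eq_sym Ja /=.
have [n nM] : exists n : nat, (M / `|J a - ln 2| < n%:R)%R.
  exists (Num.bound (M / `|J a - ln 2|)%R).
  by apply: archi_boundP; rewrite divr_ge0// /M; lra.
have := JM n a (lexx _); rewrite leNgt => /negP[].
rewrite ltr_pdivrMr// in nM; rewrite mulrC; apply: lt_le_trans nM _.
by rewrite ler_pM2r// -natrX ler_nat ltnW// ltn_expl.
Qed.

(** On the circle |a| = 1 the integrand is singular. The identity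
|t a + e|^2 / t = |a + e|^2 + (1 - t)^2 / t shows that, as t increases to 1,
the quotients |t a + e| / sqrt(t) decrease to |a + e|, so that the value passes
to the limit by monotone convergence. *)
Lemma log_circle_eq1 (a : R[i]) : modulus a = 1%R ->
  log_circle (ln 3) a 1 = (ln 3)%:E.
Proof.
move=> a1.
pose t (n : nat) : R := (n.+1%:R / n.+2%:R)%R.
pose eps (n : nat) : R := ((n.+1%:R)^-1 * (n.+2%:R)^-1)%R.
have t0 n : (0 < t n)%R by rewrite divr_gt0.
have tlt1 n : (t n < 1)%R by rewrite ltr_pdivrMr// mul1r ltr_nat.
have t12 n : (2^-1 <= t n)%R.
  by rewrite /t ler_pdivlMr// mulrC ler_pdivrMr// -natrM ler_nat; lia.
have eps0 n : (0 < eps n)%R by rewrite mulr_gt0// invr_gt0.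
have epsE n : ((1 - t n) ^+ 2 / t n = eps n)%R.
  have n1 : (n.+1%:R : R)%R != 0%R by rewrite pnatr_eq0.
  have n2 : (n.+2%:R : R)%R != 0%R by rewrite pnatr_eq0.
  have n21 : (n.+2%:R = n.+1%:R + 1 :> R)%R by rewrite -natr1.
  rewrite /t /eps; move: n1 n2; rewrite n21 => n1 n2.
  move: (n.+1%:R : R)%R n1 n2 => y y0 y1; field.
  by apply/andP.
have eps_cvg : eps n @[n --> \oo] --> 0%R.
  apply: (@squeeze_cvgr _ _ _ _ (cst 0%R) (@harmonic R)).
  - near=> n; rewrite ltW//= /eps ler_piMr// invf_le1// ler1n//.
  - exact: cvg_cst.
  - exact: cvg_harmonic.
have eps_nincr n m : (n <= m)%N -> (eps m <= eps n)%R.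
  by move=> nm; rewrite ler_pM// lef_pV2 ?posrE// ler_nat ltnS.
pose H n : R := (ln 3 + ln (t n) / 2)%R.
pose phi n (x : R) : \bar R :=
  (H n)%:E - lne (modulus ((t n)%:C%C * a + (1 : R)%:C%C * unit_circle x))%:E.
have ta n : modulus ((t n)%:C%C * a) = t n.
  by rewrite modulusM modulusC a1 mulr1 gtr0_norm.
have ln2H n : (ln 2 <= H n)%R.
  (* 4 / 9 <= 1 / 2 <= t n, and 4 / 9 is the square of 2 / 3. *)
  have : (ln (4 / 9) <= ln (t n))%R.
    by rewrite ler_ln ?posrE//; have := t12 n; lra.
  rewrite ln_div ?posrE//.
  have -> : (4 = 2 ^+ 2 :> R)%R by rewrite -natrX.
  have -> : (9 = 3 ^+ 2 :> R)%R by rewrite -natrX.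
  by rewrite !lnXn// /H; lra.
have phi_int n : \int[@circle_prob R]_x phi n x = (H n)%:E.
  have ta1 : (modulus ((t n)%:C%C * a) < 1)%R by rewrite ta.
  rewrite -/(log_circle (H n) ((t n)%:C%C * a)%R 1) -[H n](subrK (ln 2)).
  rewrite log_circle_shift ?subr_ge0//.
    by rewrite log_circle_lt1// EFinD.
  by rewrite lnK ?posrE// ta; have := tlt1 n; lra.
pose q (x : R) : R := (modulus (a + unit_circle x) ^+ 2)%R.
have q0 x : (0 <= q x)%R by rewrite sqr_ge0.
have phiE n x : phi n x = (ln 3 - ln (q x + eps n) / 2)%:E.
  have tq : (modulus ((t n)%:C%C * a + (1 : R)%:C%C * unit_circle x) ^+ 2 =
      t n * (q x + eps n))%R.
    rewrite -epsE mulrDr [(t n * (_ / _))%R]mulrCA divff ?gt_eqF// mulr1 mul1r.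
    have a2 : (complex.Re a ^+ 2 + complex.Im a ^+ 2 = 1)%R.
      by rewrite -sqr_modulus a1 expr1n.
    rewrite /q !sqr_modulus !ReD !ImD !ReCM !ImCM /=.
    have := cos2Dsin2 x; set C := cos x; set S := sin x => CS.
    move: a2; set u := complex.Re a; set v := complex.Im a => a2.
    have -> : ((t n * u + C) ^+ 2 + (t n * v + S) ^+ 2 =
       t n ^+ 2 * (u ^+ 2 + v ^+ 2) + 2 * t n * (u * C + v * S) + (C ^+ 2 + S ^+ 2))%R by ring.
    have -> : ((u + C) ^+ 2 + (v + S) ^+ 2 =
       (u ^+ 2 + v ^+ 2) + 2 * (u * C + v * S) + (C ^+ 2 + S ^+ 2))%R by ring.
    by rewrite a2 CS; ring.
  rewrite /phi; move: tq; set m := modulus _ => tq.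
  have qe0 : (0 < q x + eps n)%R by rewrite ltr_wpDl.
  have m0 : (0 < m)%R.
    rewrite lt_neqAle eq_sym modulus_ge0 andbT; apply: contraTneq (mulr_gt0 (t0 n) qe0).
    by rewrite -tq => ->; rewrite expr0n ltxx.
  rewrite lne_EFin// -EFinB; congr EFin.
  have : (ln (m ^+ 2) = ln (t n) + ln (q x + eps n))%R by rewrite tq lnM ?posrE.
  by rewrite lnXn// /H; lra.
have mphi n : measurable_fun setT (phi n) by exact: measurable_log_circle.
have phi0 n x : 0 <= phi n x.
  apply: log_circle_integrand_ge0 => //; rewrite ta.
  apply: le_trans (_ : expR (ln 2) <= _)%R; last by rewrite ler_expR.
  by rewrite lnK ?posrE//; have := tlt1 n; lra.
have phi_nd x n m : (n <= m)%N -> phi n x <= phi m x.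
  move=> nm; rewrite !phiE lee_fin lerD2l lerN2 ler_pM2r ?invr_gt0//.
  by rewrite ler_ln ?posrE ?ltr_wpDl// lerD2l eps_nincr.
have phi_cvg x : phi n x @[n --> \oo] -->
    (ln 3)%:E - lne (modulus (a + (1 : R)%:C%C * unit_circle x))%:E.
  rewrite mul1r; under eq_fun do rewrite phiE.
  have [ae0|ae0] := eqVneq (modulus (a + unit_circle x)) 0%R.
    rewrite ae0 /= lexx /=; apply/cvgeyPge => A; near=> n.
    rewrite lee_fin /q ae0 expr0n add0r.
    have : (eps n <= expR (2 * (ln 3 - A)))%R.
      by apply: ltW; near: n; apply: (cvgr_lt 0%R) => //; exact: expR_gt0.
    by rewrite -[X in (X <= _)%R](lnK (eps0 n)) ler_expR; lra.
  have m0 : (0 < modulus (a + unit_circle x))%R.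
    by rewrite lt_neqAle eq_sym ae0 modulus_ge0.
  rewrite lne_EFin// -EFinB; apply: cvg_EFin; first exact: nearW.
  have -> : (ln 3 - ln (modulus (a + unit_circle x)) = ln 3 - ln (q x + 0) / 2)%R.
    by rewrite addr0 /q lnXn//; lra.
  apply: cvgB; first exact: cvg_cst.
  apply: cvgM; last exact: cvg_cst.
  apply: continuous_cvg; first by apply: continuous_ln; rewrite addr0 exprn_gt0.
  by apply: cvgD; [exact: cvg_cst|exact: eps_cvg].
have := @cvg_monotone_convergence _ _ _ (@circle_prob R) setT measurableT phi
  (fun n => mphi n) (fun n x _ => phi0 n x) (fun x _ n m nm => phi_nd x n m nm).
have -> : (fun n => \int[circle_prob]_x phi n x) = (fun n => (H n)%:E).
  by apply/funext => n; rewrite phi_int.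
have -> : \int[circle_prob]_x limn (phi ^~ x) = log_circle (ln 3) a 1.
  by apply: eq_integral => x _; apply/cvg_lim => //; exact: phi_cvg.
move=> /cvg_lim <- //; apply/cvg_lim => //; apply: cvg_EFin; first exact: nearW.
have -> : (ln 3 = ln 3 + ln 1 / 2 :> R)%R by rewrite ln1 mul0r addr0.
apply: cvgD; first exact: cvg_cst.
apply: cvgM; last exact: cvg_cst.
apply: continuous_cvg; first by apply: continuous_ln.
have -> : t = (fun n => 1 - (@harmonic R) n.+1)%R.
  apply/funext => n; rewrite /t /harmonic /=.
  have n2 : (n.+2%:R : R)%R != 0%R by rewrite pnatr_eq0.
  rewrite -[in LHS](addrK 1%R (n.+1%:R)%R) natr1 mulrBl divff//.
  by rewrite mul1r.
rewrite -[X in _ --> X]subr0; apply: cvgB; first exact: cvg_cst.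
by have := @cvg_harmonic R; rewrite -cvg_shiftS.
Unshelve. all: end_near. Qed.

Lemma log_circle_le1 (a : R[i]) : (modulus a <= 1)%R ->
  log_circle (ln 2) a 1 = (ln 2)%:E.
Proof.
rewrite le_eqVlt => /orP[/eqP a1|]; last exact: log_circle_lt1.
have ln23 : (0 <= ln 3 - ln 2 :> R)%R by rewrite subr_ge0 ler_ln ?posrE// ler_nat.
have := log_circle_eq1 a1; rewrite -[X in log_circle X](subrK (ln 2 : R)).
rewrite log_circle_shift//; last by rewrite lnK ?posrE// a1.
move/(congr1 (fun z => z - (ln 3 - ln 2)%:E)).
by rewrite [X in X - _]addeC addeK// -EFinB => ->; congr EFin; lra.
Qed.

Lemma log_circle_scale (H s r : R) (a b : R[i]) : (0 < s)%R -> (modulus b <= 1)%R ->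
  (forall x, modulus (a + r%:C%C * unit_circle x) = s * modulus (b + unit_circle x))%R ->
  (s * (modulus b + 1) <= expR H)%R ->
  log_circle H a r = (H - ln s)%:E.
Proof.
move=> s0 b1 abE sbH.
have bH : (modulus b + 1 <= expR (H - ln s))%R.
  by rewrite expRD expRN lnK ?posrE// ler_pdivlMr// mulrC.
have H0 : (0 <= H - ln s)%R.
  by rewrite -ler_expR expR0 (le_trans _ bH)// lerDr modulus_ge0.
have -> : log_circle H a r = log_circle (H - ln s) b 1.
  apply: eq_integral => x _; rewrite abE mul1r.
  have := modulus_ge0 (b + unit_circle x)%R; rewrite le_eqVlt.
  move=> /orP[/eqP <-|m0]; first by rewrite mulr0 /= lexx.
  rewrite !lne_EFin ?mulr_gt0// lnM ?posrE// -!EFinB; congr EFin.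
  by rewrite opprD addrA.
have ln20 : (0 <= ln 2 :> R)%R by rewrite ln_ge0// ler1n.
have /(congr1 (fun z => z - (ln 2)%:E)) :
    (ln 2)%:E + log_circle (H - ln s) b 1 = (ln 2)%:E + (H - ln s)%:E.
  rewrite -log_circle_shift// addrC log_circle_shift//.
    by rewrite log_circle_le1// addeC.
  by rewrite lnK ?posrE// -[leRHS]/(1 + 1)%R lerD2r.
by rewrite [X in X - _]addeC addeK// [X in X - _]addeC addeK.
Qed.

(** Jensen's formula for a polynomial of degree one. Dividing by max(|a|, r), and
exchanging the roles of a and r e when |a| > r, leaves a point of the closed unit
disc and radius 1. *)
Lemma log_circleE (H r : R) (a : R[i]) : (0 < r)%R ->
  (modulus a + r <= expR H)%R ->
  log_circle H a r = (H - ln (Num.max (modulus a) r))%:E.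
Proof.
move=> r0 arH; have [ar|ra] := leP (modulus a) r.
  have mb : modulus (r^-1%:C%C * a) = (modulus a / r)%R.
    by rewrite modulusM modulusC gtr0_norm ?invr_gt0// mulrC.
  have rr : (r%:C%C * r^-1%:C%C = 1 :> R[i])%R by rewrite -rmorphM divff ?gt_eqF.
  apply: (@log_circle_scale _ _ _ _ (r^-1%:C%C * a)%R) => //.
  - by rewrite mb ler_pdivrMr// mul1r.
  - move=> x; rewrite -[X in (_ = X * _)%R](gtr0_norm r0) -modulusC -modulusM.
    by rewrite mulrDr mulrA rr mul1r.
  - by rewrite mb mulrDr mulr1 mulrCA divff ?gt_eqF// mulr1.
have a0 : (0 < modulus a)%R by exact: lt_trans ra.
have an0 : a != 0%R by rewrite -modulus_eq0 gt_eqF.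
have mb : modulus (conjc (r%:C%C / a)%R) = (r / modulus a)%R.
  rewrite modulus_conj modulusM modulusC gtr0_norm//; congr (_ * _)%R.
  exact: Normc.normcV.
apply: (@log_circle_scale _ _ _ _ (conjc (r%:C%C / a)%R)) => //.
- by rewrite mb ler_pdivrMr// mul1r ltW.
- move=> x; rewrite modulus_conjD -modulusM; congr modulus.
  by rewrite conjcK mulrDr mulr1 addrC mulrA mulrCA divff// mulr1.
- by rewrite mb mulrDr mulr1 mulrCA divff ?gt_eqF// mulr1 addrC.
Qed.

End CircleLogValue.

(** * Circle means of squares and the measure of the plane *)

Section CircleSquare.
Context {R : realType}.

(** Two opposite points of the circle average out the cross term. *)
Lemma circle_mean_sqr (u : R[i]) (r : R) :
  \int[@circle_prob R]_x (modulus (u - r%:C%C * unit_circle x) ^+ 2)%:E =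
  (modulus u ^+ 2 + r ^+ 2)%:E.
Proof.
pose f (x : R) : \bar R := (modulus (u - r%:C%C * unit_circle x) ^+ 2)%:E.
have mf : measurable_fun setT f.
  apply/measurable_EFinP; apply: measurable_funX.
  have -> : (fun x : R => modulus (u - r%:C%C * unit_circle x)) =
      (fun x : R => modulus (u + (- r)%:C%C * unit_circle x)).
    by apply/funext => x; rewrite rmorphN mulNr.
  exact: measurable_shifted_circle.
have f0 x : 0 <= f x by rewrite lee_fin sqr_ge0.
have fper x : f (x + pi *+ 2)%R = f x by rewrite /f unit_circleD2pi.
have ff x : f x + f (x + pi)%R = (2 * (modulus u ^+ 2 + r ^+ 2))%:E.
  rewrite /f unit_circleDpi -EFinD; congr EFin.
  have h : (complex.Re (unit_circle x) ^+ 2 + complex.Im (unit_circle x) ^+ 2 = 1)%R.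
    by rewrite -sqr_modulus modulus_circle expr1n.
  rewrite mulrN opprK !sqr_modulus !ReB !ImB !ReD !ImD !ReCM !ImCM.
  move: h; set p := complex.Re (unit_circle x); set q := complex.Im (unit_circle x) => h.
  have -> : (r ^+ 2 = r ^+ 2 * (p ^+ 2 + q ^+ 2))%R by rewrite h mulr1.
  by ring.
have : \int[@circle_prob R]_x (f x + f (x + pi)%R) =
    \int[@circle_prob R]_x f x + \int[@circle_prob R]_x f x.
  rewrite ge0_integralD//.
  - by rewrite (@circle_half_turn _ f).
  - by apply: (measurableT_comp mf); exact: measurable_funD.
under eq_integral do rewrite ff.
rewrite circle_integral_cst -/(\int[circle_prob]_x f x).
have : 0 <= \int[@circle_prob R]_x f x by exact: integral_ge0.
case: (\int[circle_prob]_x f x) => [s| |]//= _ [].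
by move=> h; congr EFin; lra.
Qed.

End CircleSquare.

Section PlaneMeasure.
Context {R : realType}.
Local Notation lambda := (@lebesgue_measure R).
Local Notation lambda2 := (lambda \x lambda)%E.

Definition complex_of_pair (p : measurableTypeR R * measurableTypeR R) : borelC R :=
  Complex (p.1 : R) (p.2 : R).

Lemma measurable_complex_of_pair : measurable_fun setT complex_of_pair.
Proof. by apply: measurable_ReIm => /=; [exact: measurable_fst|exact: measurable_snd]. Qed.

Definition plane_measure (A : set (borelC R)) : \bar R :=
  lambda2 (complex_of_pair @^-1` A).

Let plane_measure0 : plane_measure set0 = 0.
Proof. by rewrite /plane_measure preimage_set0 measure0. Qed.

Let plane_measure_ge0 A : 0 <= plane_measure A.
Proof. exact: measure_ge0. Qed.

Let plane_measure_sigma_additive : semi_sigma_additive plane_measure.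
Proof.
move=> F mF tF mUF; rewrite /plane_measure preimage_bigcup.
apply: measure_semi_sigma_additive.
- by move=> n; rewrite -[X in measurable X]setTI; exact: measurable_complex_of_pair.
- apply/trivIsetP => /= i j _ _ ij; rewrite -preimage_setI.
  by move/trivIsetP : tF => /(_ _ _ _ _ ij) ->//; rewrite preimage_set0.
- by rewrite -preimage_bigcup -[X in measurable X]setTI; exact: measurable_complex_of_pair.
Qed.

HB.instance Definition _ := isMeasure.Build _ _ _ plane_measure
  plane_measure0 plane_measure_ge0 plane_measure_sigma_additive.

Definition disc (a : R[i]) (r : R) : set (borelC R) :=
  [set z | (modulus (a - (z : R[i])) < r)%R].

Lemma measurable_disc a r : measurable (disc a r).
Proof. by apply: open_measurableC; exact: open_disc. Qed.

Lemma plane_measure_disc_lty r : plane_measure (disc 0%R r) < +oo.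
Proof.
have [r0|r0] := leP r 0%R.
  rewrite (_ : disc 0%R r = set0) ?measure0// -subset0 => z /=.
  by rewrite /disc/= ltNge (le_trans r0)// modulus_ge0.
apply: (@le_lt_trans _ _ (lambda2 (`[(- r)%R, r] `*` `[(- r)%R, r]))).
  apply: (@le_measure _ _ _ lambda2); rewrite ?inE.
  - by rewrite -[X in measurable X]setTI; exact: measurable_complex_of_pair (measurable_disc _ _).
  - exact: measurableX.
  - move=> [x y] xyr0; rewrite /= !in_itv/= -!ler_norml.
    have : (modulus (0 - (x +i* y)%C) < r)%R by exact: xyr0.
    rewrite sub0r modulusN => xyr.
    by split; apply: le_trans (ltW xyr);
      [exact: (Re_le_modulus (x +i* y)%C)|exact: (Im_le_modulus (x +i* y)%C)].
have E : lambda `[(- r)%R, r]%classic = (r - - r)%:E.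
  by rewrite lebesgue_measure_itv/= lte_fin gtrN.
have -> : lambda2 (`[(- r)%R, r] `*` `[(- r)%R, r]) = (r - - r)%:E * (r - - r)%:E.
  by rewrite product_measure1E//; congr (_ * _); exact: E.
exact: ltry.
Qed.

(** The disc contains the square of side r / 4 with lower left corner a. *)
Lemma plane_measure_disc_ge a r : (0 <= r)%R ->
  ((r / 4) ^+ 2)%:E <= plane_measure (disc a r).
Proof.
rewrite le_eqVlt => /orP[/eqP <-|r0]; first by rewrite mul0r expr0n measure_ge0.
pose I (s : R) := `[s, (s + r / 4)%R]%classic.
apply: (@le_trans _ _ (lambda2 (I (complex.Re a) `*` I (complex.Im a)))).
  have E s : lambda (I s) = (r / 4)%:E.
    rewrite lebesgue_measure_itv/= lte_fin ltrDl divr_gt0//.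
    by rewrite -EFinB [(_ + r / 4)%R]addrC addrK.
  have -> : lambda2 (I (complex.Re a) `*` I (complex.Im a)) = (r / 4)%:E * (r / 4)%:E.
    rewrite product_measure1E; [|exact: measurable_itv..].
    by congr (_ * _); exact: E.
  by rewrite -EFinM -expr2.
apply: (@le_measure _ _ _ lambda2); rewrite ?inE.
- by apply: measurableX; exact: measurable_itv.
- by rewrite -[X in measurable X]setTI; exact: measurable_complex_of_pair (measurable_disc _ _).
- move=> [x y]; rewrite /I /disc /= !in_itv/= => -[/andP[x1 x2] /andP[y1 y2]].
  apply: le_lt_trans (modulus_le_ReIm _) _; rewrite ReB ImB /=.
  have : (`|complex.Re a - x| <= r / 4)%R by rewrite ler_norml; apply/andP; split; lra.
  have : (`|complex.Im a - y| <= r / 4)%R by rewrite ler_norml; apply/andP; split; lra.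
  by lra.
Qed.

Let plane_measure_sigma_finite : sigma_finite setT plane_measure.
Proof.
exists (fun n => disc 0%R n%:R).
  apply/esym; rewrite -subTset => z _; exists (Num.bound (modulus z)) => //=.
  by rewrite /disc/= sub0r modulusN archi_boundP// modulus_ge0.
by move=> n; split; [exact: measurable_disc|exact: plane_measure_disc_lty].
Qed.

HB.instance Definition _ := Measure_isSigmaFinite.Build _ _ _ plane_measure
  plane_measure_sigma_finite.

Lemma measurable_shiftC (a : R[i]) :
  measurable_fun setT (fun z : borelC R => (z : R[i]) + a : borelC R)%R.
Proof.
apply: measurable_ReIm.
- under eq_fun do rewrite ReD; apply: measurable_funD => //; exact: measurable_Re.
- under eq_fun do rewrite ImD; apply: measurable_funD => //; exact: measurable_Im.
Qed.

Lemma plane_integral_shift (a : R[i]) (f : borelC R -> \bar R) :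
  measurable_fun setT f -> (forall z, 0 <= f z) ->
  \int[plane_measure]_z f ((z : R[i]) + a)%R = \int[plane_measure]_z f z.
Proof.
move=> mf f0.
have iterated (g : borelC R -> \bar R) : measurable_fun setT g -> (forall z, 0 <= g z) ->
    \int[plane_measure]_z g z = \int[lambda]_x \int[lambda]_y g (complex_of_pair (x, y)).
  move=> mg g0.
  rewrite (ge0_integral_pushforward measurable_complex_of_pair lambda2 measurableT)//.
  rewrite preimage_setT -(fubini_tonelli1 (g \o complex_of_pair))//.
  - exact: measurableT_comp mg measurable_complex_of_pair.
  - by move=> p; exact: g0.
have mfC (x : R) : measurable_fun setT (fun y : R => f (complex_of_pair (x, y))).
  apply: (measurableT_comp mf); apply: (measurableT_comp measurable_complex_of_pair).
  exact: pair1_measurable.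
rewrite (iterated (fun z => f ((z : R[i]) + a)%R)
  (measurableT_comp mf (measurable_shiftC a)) (fun z => f0 _)).
rewrite (iterated f mf f0).
have shift (g : R -> \bar R) (d : R) : measurable_fun setT g -> (forall x, 0 <= g x) ->
    \int[lambda]_x g x = \int[lambda]_x g (x + d)%R.
  move=> mg g0; have := @integral_affine R 1 d setT g ltr01 measurableT mg g0.
  rewrite preimage_setT mul1e => ->.
  by apply: eq_integral => x _; rewrite mul1r.
pose F x := \int[lambda]_y f (complex_of_pair (x, y)).
have mF : measurable_fun setT F.
  exact: (measurable_fun_fubini_tonelli_F (f \o complex_of_pair)
    (measurableT_comp mf measurable_complex_of_pair) (fun p => f0 _)).
have F0 x : 0 <= F x by exact: integral_ge0.
rewrite [RHS](shift F (complex.Re a) mF F0).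
apply: eq_integral => x _.
rewrite /F (shift _ (complex.Im a) (mfC _) (fun y => f0 _)).
by apply: eq_integral => y _; case: a {shift}.
Qed.

End PlaneMeasure.

(** * The truncated logarithm and its deficit *)

Section LogKernel.
Context {R : realType}.
Implicit Types (r : R) (a z t : R[i]).

(** The logarithm truncated at radius r, normalized so as to be nonnegative: its
integrals need no integrability assumption. *)
Definition log_kernel r a : R := (ln (Num.max (modulus a) r) - ln r)%R.

Lemma log_kernel_ge0 r a : (0 < r)%R -> (0 <= log_kernel r a)%R.
Proof.
by move=> r0; rewrite subr_ge0 ler_ln ?posrE// ?lt_max ?r0 ?orbT// le_max lexx orbT.
Qed.

Lemma log_kernel_le r s a : (0 < r)%R -> (r <= s)%R -> (modulus a <= s)%R ->
  (log_kernel r a <= ln s - ln r)%R.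
Proof.
move=> r0 rs as_; rewrite lerD2r ler_ln ?posrE ?(lt_le_trans r0)//.
- by rewrite ge_max as_ rs.
- by rewrite le_max lexx orbT.
Qed.

Lemma log_kernel_near r a : (modulus a <= r)%R -> log_kernel r a = 0%R.
Proof. by move=> /max_idPr ar; rewrite /log_kernel ar subrr. Qed.

Lemma log_kernel_far r a : (r <= modulus a)%R -> log_kernel r a = (ln (modulus a) - ln r)%R.
Proof. by move=> /max_idPl ar; rewrite /log_kernel ar. Qed.

Lemma measurable_log_kernel r : measurable_fun setT (log_kernel r : borelC R -> R).
Proof.
apply: measurable_funB => //; apply: measurableT_comp => //.
by apply: measurable_maxr => //; exact: measurable_modulus.
Qed.

Lemma log_kernel_log1 r z t : (0 < r)%R ->
  (log_kernel r (z - t) <= (ln (1 + modulus z + r) - ln r) + ln (1 + modulus t))%R.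
Proof.
move=> r0; have z0 := modulus_ge0 z; have t0 := modulus_ge0 t.
rewrite addrAC -lnM ?posrE; [|lra..].
apply: log_kernel_le => //; first by rewrite -[leLHS]mulr1 ler_pM//; lra.
apply: le_trans (modulusD _ _) _; rewrite modulusN.
have : (0 <= modulus z * modulus t)%R by rewrite mulr_ge0.
have : (0 <= r * modulus t)%R by rewrite mulr_ge0// ltW.
by lra.
Qed.

(** The radius 2 r exceeds the radius of truncation: about the points of the disc
of radius r, where the kernel vanishes, the mean is at least log 2. *)
Definition mean_kernel r a : \bar R :=
  \int[@circle_prob R]_x (log_kernel r (a + (2 * r)%:C%C * unit_circle x))%:E.

Lemma measurable_log_kernel_circle r a s : measurable_fun setT
  (fun x : R => (log_kernel r (a + s%:C%C * unit_circle x))%:E).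
Proof.
apply/measurable_EFinP; apply: measurable_funB => //; apply: measurableT_comp => //.
by apply: measurable_maxr => //; exact: measurable_shifted_circle.
Qed.

Lemma modulus_circle2_le r a x : (0 < r)%R ->
  (modulus (a + (2 * r)%:C%C * unit_circle x) <= modulus a + 2 * r)%R.
Proof. by move=> r0; apply: modulus_shifted_circle_le; lra. Qed.

Lemma mean_kernel_le r a : (0 < r)%R ->
  mean_kernel r a <= (ln (modulus a + 2 * r) - ln r)%:E.
Proof.
move=> r0; have a0 := modulus_ge0 a.
rewrite -(circle_integral_cst (ln (modulus a + 2 * r) - ln r)%:E).
apply: ge0_le_integral => //.
- by move=> x _; rewrite lee_fin log_kernel_ge0.
- exact: measurable_log_kernel_circle.
- move=> x _; rewrite lee_fin log_kernel_le//; first by lra.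
  exact: modulus_circle2_le.
Qed.

Lemma mean_kernel_fin r a : (0 < r)%R -> mean_kernel r a \is a fin_num.
Proof.
move=> r0; rewrite ge0_fin_numE; first exact: le_lt_trans (mean_kernel_le a r0) (ltry _).
by apply: integral_ge0 => x _; rewrite lee_fin log_kernel_ge0.
Qed.

Lemma mean_kernelD r a (H : R) : (0 < r)%R -> (modulus a + 2 * r <= expR H)%R ->
  \int[@circle_prob R]_x
    (H - ln (Num.max (modulus (a + (2 * r)%:C%C * unit_circle x)) r))%:E
  = (H - ln r)%:E - mean_kernel r a.
Proof.
move=> r0 arH; have a0 := modulus_ge0 a.
rewrite -[LHS](addeK _ (mean_kernel_fin a r0)); congr (_ - _).
rewrite -ge0_integralD//=.
- rewrite -[RHS]circle_integral_cst; apply: eq_integral => x _.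
  by rewrite -EFinD; congr EFin; rewrite /log_kernel; lra.
- move=> x _; rewrite lee_fin subr_ge0 -ler_expR lnK ?posrE ?lt_max ?r0 ?orbT//.
  rewrite ge_max (le_trans (modulus_circle2_le a x r0) arH)/=.
  by apply: le_trans arH; lra.
- apply/measurable_EFinP; apply: measurable_funB => //; apply: measurableT_comp => //.
  by apply: measurable_maxr => //; exact: measurable_shifted_circle.
- by move=> x _; rewrite lee_fin log_kernel_ge0.
- exact: measurable_log_kernel_circle.
Qed.

(** Truncation can only increase the kernel, and [log_circleE] gives the mean of the
untruncated logarithm. *)
Lemma mean_kernel_ge r a : (0 < r)%R ->
  (ln (Num.max (modulus a) (2 * r)) - ln r)%:E <= mean_kernel r a.
Proof.
move=> r0; have a0 := modulus_ge0 a.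
pose H := ln (modulus a + 2 * r).
have arH : (modulus a + 2 * r <= expR H)%R by rewrite lnK ?posrE//; lra.
have : (H - ln r)%:E - mean_kernel r a <= log_circle H a (2 * r).
  rewrite -mean_kernelD//; apply: ge0_le_integral => //.
  - move=> x _; rewrite lee_fin subr_ge0 -ler_expR lnK ?posrE ?lt_max ?r0 ?orbT//.
    rewrite ge_max (le_trans (modulus_circle2_le a x r0) arH)/=.
    by apply: le_trans arH; lra.
  - apply/measurable_EFinP; apply: measurable_funB => //; apply: measurableT_comp => //.
    by apply: measurable_maxr => //; exact: measurable_shifted_circle.
  - exact: measurable_log_circle.
  - move=> x _; rewrite EFinB leeB// lne_ge_expR//.
    by rewrite lnK ?posrE ?lt_max ?r0 ?orbT// le_max lexx.
rewrite log_circleE//; last by rewrite mulr_gt0.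
rewrite -(fineK (mean_kernel_fin a r0)) -EFinB !lee_fin; lra.
Qed.

(** From |a| >= 3 r the circle misses the disc of truncation, and log|.| has the
mean value property. *)
Lemma mean_kernel_far r a : (0 < r)%R -> (3 * r <= modulus a)%R ->
  mean_kernel r a = (log_kernel r a)%:E.
Proof.
move=> r0 ar; have a0 := modulus_ge0 a.
pose H := ln (modulus a + 2 * r).
have arH : (modulus a + 2 * r <= expR H)%R by rewrite lnK ?posrE//; lra.
have : (H - ln r)%:E - mean_kernel r a = log_circle H a (2 * r).
  rewrite -mean_kernelD//; apply: eq_integral => x _.
  have mr : (r <= modulus (a + (2 * r)%:C%C * unit_circle x))%R.
    have := le_modulusB a (- ((2 * r)%:C%C * unit_circle x))%R.
    rewrite opprK modulusN modulusM modulusC modulus_circle mulr1 ger0_norm; lra.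
  by rewrite (max_idPl mr) lne_EFin// (lt_le_trans r0).
rewrite log_circleE//; last by rewrite mulr_gt0.
rewrite -(fineK (mean_kernel_fin a r0)) -EFinB => -[].
rewrite (max_idPl _); last by lra.
rewrite log_kernel_far; last by lra.
by move=> h; congr EFin; lra.
Qed.

(** This plays the role of the Laplacian of the kernel, a multiple of the Dirac
mass smeared over the disc of radius 3 r. *)
Definition deficit r a : R := (fine (mean_kernel r a) - log_kernel r a)%R.

Lemma deficitE r a : (0 < r)%R ->
  mean_kernel r a = (log_kernel r a)%:E + (deficit r a)%:E.
Proof.
by move=> r0; rewrite -EFinD /deficit subrKC fineK// mean_kernel_fin.
Qed.

Lemma deficit_ge0 r a : (0 < r)%R -> (0 <= deficit r a)%R.
Proof.
move=> r0; rewrite subr_ge0 -lee_fin fineK ?mean_kernel_fin//.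
apply: le_trans (mean_kernel_ge a r0); rewrite lee_fin lerD2r.
rewrite ler_ln ?posrE ?lt_max ?r0 ?mulr_gt0 ?orbT//.
by rewrite ge_max !le_max lexx /=; apply/orP; right; lra.
Qed.

Lemma deficit_far r a : (0 < r)%R -> (3 * r <= modulus a)%R -> deficit r a = 0%R.
Proof. by move=> r0 ar; rewrite /deficit mean_kernel_far//= subrr. Qed.

Lemma deficit_near r a : (0 < r)%R -> (modulus a <= r)%R -> (ln 2 <= deficit r a)%R.
Proof.
move=> r0 ar; rewrite /deficit log_kernel_near// subr0 -lee_fin fineK ?mean_kernel_fin//.
apply: le_trans (mean_kernel_ge a r0); rewrite (max_idPr _); last by lra.
by rewrite lnM ?posrE// lee_fin; lra.
Qed.

Lemma deficit_le r a : (0 < r)%R -> (deficit r a <= ln 5)%R.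
Proof.
move=> r0; have [ar|ar] := leP (3 * r)%R (modulus a).
  by rewrite deficit_far// ln_ge0// ler1n.
rewrite lerBlDl (@le_trans _ _ (ln 5))//; last by rewrite lerDr log_kernel_ge0.
rewrite -lee_fin fineK ?mean_kernel_fin//.
apply: le_trans (mean_kernel_le a r0) _; rewrite lee_fin.
have a0 := modulus_ge0 a.
have : (ln (modulus a + 2 * r) <= ln (5 * r))%R by rewrite ler_ln ?posrE//; lra.
by rewrite lnM ?posrE//; lra.
Qed.

End LogKernel.

(** * Potentials and their regularizations *)

Section MeasurabilityC.
Context {R : realType}.

Lemma measurable_subC :
  measurable_fun setT (fun p : borelC R * borelC R => ((p.1 : R[i]) - p.2 : borelC R)%R).
Proof.
apply: measurable_ReIm.
- under eq_fun do rewrite ReB; apply: measurable_funB.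
  + exact: (measurableT_comp measurable_Re measurable_fst).
  + exact: (measurableT_comp measurable_Re measurable_snd).
- under eq_fun do rewrite ImB; apply: measurable_funB.
  + exact: (measurableT_comp measurable_Im measurable_fst).
  + exact: (measurableT_comp measurable_Im measurable_snd).
Qed.

Lemma measurable_addC_circle (s : R) : measurable_fun setT
  (fun p : borelC R * measurableTypeR R =>
    ((p.1 : R[i]) + s%:C%C * unit_circle p.2 : borelC R)%R).
Proof.
have mc := measurableT_comp (@measurable_unit_circle R)
  (@measurable_snd _ _ (borelC R) (measurableTypeR R)).
apply: measurable_ReIm.
- under eq_fun do rewrite ReD ReCM; apply: measurable_funD.
  + exact: (measurableT_comp measurable_Re measurable_fst).
  + by apply: measurable_funM => //; exact: (measurableT_comp measurable_Re mc).
- under eq_fun do rewrite ImD ImCM; apply: measurable_funD.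
  + exact: (measurableT_comp measurable_Im measurable_fst).
  + by apply: measurable_funM => //; exact: (measurableT_comp measurable_Im mc).
Qed.

Lemma measurable_subC_circle (z : R[i]) (s : R) : measurable_fun setT
  (fun p : measurableTypeR R * borelC R =>
    (z + s%:C%C * unit_circle p.1 - (p.2 : R[i]) : borelC R)%R).
Proof.
have mzc : measurable_fun setT (fun p : measurableTypeR R * borelC R =>
    (z + s%:C%C * unit_circle p.1 : borelC R)%R).
  exact: (measurableT_comp (measurable_addC_circle s)
    (measurable_fun_pair (measurable_cst (z : borelC R)) measurable_fst)).
exact: (measurableT_comp measurable_subC (measurable_fun_pair mzc measurable_snd)).
Qed.

Lemma measurable_mean_kernel (r : R) : (0 < r)%R ->
  measurable_fun setT (mean_kernel r : borelC R -> \bar R).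
Proof.
move=> r0; pose F (p : borelC R * measurableTypeR R) : \bar R :=
  (log_kernel r ((p.1 : R[i]) + (2 * r)%:C%C * unit_circle p.2))%:E.
have mF : measurable_fun setT F.
  apply/measurable_EFinP.
  exact: (measurableT_comp (measurable_log_kernel r) (measurable_addC_circle _)).
have F0 p : 0 <= F p by rewrite lee_fin log_kernel_ge0.
exact: (measurable_fun_fubini_tonelli_F (m2 := @circle_prob R) F mF F0).
Qed.

Lemma measurable_deficit (r : R) : (0 < r)%R ->
  measurable_fun setT (deficit r : borelC R -> R).
Proof.
move=> r0; apply: measurable_funB; last exact: measurable_log_kernel.
by apply: (measurableT_comp (fine_measurable measurableT)); exact: measurable_mean_kernel.
Qed.

End MeasurabilityC.

Section Potentials.
Context {R : realType}.
Variable sigma : {finite_measure set (borelC R) -> \bar R}.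
Hypothesis sigma_log : integrates_log_at_infinity sigma.
Implicit Types (r : R) (z p : R[i]).

Lemma measurable_log1 :
  measurable_fun setT (fun t : borelC R => ln (1 + modulus (t : R[i])))%R.
Proof.
by apply: measurableT_comp => //; apply: measurable_funD => //; exact: measurable_modulus.
Qed.

Lemma log1_ge0 (t : R[i]) : (0 <= ln (1 + modulus t))%R.
Proof. by rewrite ln_ge0// lerDl modulus_ge0. Qed.

Lemma integrable_log1 (k : R) : sigma.-integrable setT
  (fun t : borelC R => (k + ln (1 + modulus (t : R[i])))%:E).
Proof.
under eq_fun do rewrite EFinD.
apply: integrableD => //; first exact: finite_measure_integrable_cst.
apply/integrableP; split; first by apply/measurable_EFinP; exact: measurable_log1.
apply: le_lt_trans sigma_log; rewrite le_eqVlt; apply/orP; left; apply/eqP.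
by apply: eq_integral => t _; rewrite gee0_abs// lee_fin log1_ge0.
Qed.

Lemma measurable_lne_sub p :
  measurable_fun setT (fun t : borelC R => lne (modulus (p - (t : R[i])))%:E).
Proof.
apply: measurable_lne; apply: (measurableT_comp measurable_modulus).
exact: (measurableT_comp measurable_subC (pair1_measurable (p : borelC R))).
Qed.

(** From |p - t| <= (1 + |p|) (1 + |t|): a majorant of the logarithm that is
integrable in t and uniform for p in a disc. *)
Lemma lne_sub_le p s (t : R[i]) : (modulus p <= s)%R ->
  lne (modulus (p - t))%:E <= (ln (1 + s) + ln (1 + modulus t))%:E.
Proof.
move=> ps; have p0 := modulus_ge0 p; have t0 := modulus_ge0 t.
apply: lne_ge_expR; rewrite expRD !lnK ?posrE; [|lra..].
apply: le_trans (modulusD _ _) _; rewrite modulusN.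
have : (0 <= s * modulus t)%R by rewrite mulr_ge0//; lra.
by lra.
Qed.

(** The positive part of the logarithm is integrable, so a finite potential
makes the negative part integrable too. *)
Lemma integrable_potential p : log_potential sigma p \is a fin_num ->
  sigma.-integrable setT (fun t : borelC R => lne (modulus (p - (t : R[i])))%:E).
Proof.
set f := (fun t : borelC R => _); rewrite /log_potential -/f fin_numN => fin_f.
have mf : measurable_fun setT f by exact: measurable_lne_sub.
have fpos : \int[sigma]_t f^\+ t < +oo.
  have /integrableP[mk] := integrable_log1 (ln (1 + modulus p)).
  apply: le_lt_trans; apply: ge0_le_integral => //.
  - exact: measurable_funepos.
  - exact: measurableT_comp.
  - move=> t _; rewrite funeposE ge_max; apply/andP; split; last exact: abse_ge0.
    by apply: le_trans (lne_sub_le t (lexx _)) (lee_abs _).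
have fneg : \int[sigma]_t f^\- t < +oo.
  move: fin_f; rewrite integralE ltey.
  by case: (\int[sigma]_t f^\- t) => [s| |]//; case: (\int[sigma]_t f^\+ t) => [s| |].
apply/integrableP; split => //.
have -> : (fun t => `|f t|) = (fun t => f^\+ t + f^\- t).
  by apply/funext => t; rewrite -[RHS]/((f^\+ \+ f^\-) t) -fune_abse.
rewrite ge0_integralD//; first by rewrite lte_add_pinfty.
- exact: measurable_funepos.
- exact: measurable_funeneg.
Qed.

Definition log1_mass k : \bar R :=
  \int[sigma]_t (k + ln (1 + modulus (t : R[i])))%:E.

Lemma log1_mass_fin k : log1_mass k \is a fin_num.
Proof. exact: integrable_fin_num (integrable_log1 k). Qed.

Lemma potential_split p s : (modulus p <= s)%R -> log_potential sigma p \is a fin_num ->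
  \int[sigma]_t ((ln (1 + s) + ln (1 + modulus (t : R[i])))%:E
    - lne (modulus (p - (t : R[i])))%:E) = log1_mass (ln (1 + s)) + log_potential sigma p.
Proof.
move=> ps fin_p; rewrite integralB//; first exact: integrable_log1.
exact: integrable_potential.
Qed.

(** Tonelli gives the measurability of the integral of the nonnegative function
log(1 + |z|) + log(1 + |t|) - log|z - t|; the first two terms can be subtracted
again where the potential is finite. *)
Lemma measurable_potential_on : exists2 g : borelC R -> \bar R,
  measurable_fun setT g &
  forall z : R[i], log_potential sigma z \is a fin_num -> log_potential sigma z = g z.
Proof.
pose F (q : borelC R * borelC R) : \bar R :=
  (ln (1 + modulus (q.1 : R[i])) + ln (1 + modulus (q.2 : R[i])))%:E
   - lne (modulus ((q.1 : R[i]) - q.2))%:E.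
have mF : measurable_fun setT F.
  apply: emeasurable_funB.
    apply/measurable_EFinP; apply: measurable_funD.
    - exact: (measurableT_comp measurable_log1 measurable_fst).
    - exact: (measurableT_comp measurable_log1 measurable_snd).
  by apply: measurable_lne; exact: (measurableT_comp measurable_modulus measurable_subC).
have F0 q : 0 <= F q by rewrite sube_ge0 ?lne_sub_le ?orbT.
exists (fun z => \int[sigma]_t F (z, t) - log1_mass (ln (1 + modulus (z : R[i])))).
  apply: emeasurable_funB; first exact: (measurable_fun_fubini_tonelli_F F mF F0).
  apply: (measurable_fun_fubini_tonelli_F (fun q : borelC R * borelC R =>
    (ln (1 + modulus (q.1 : R[i])) + ln (1 + modulus (q.2 : R[i])))%:E)).
    apply/measurable_EFinP; apply: measurable_funD.
    - exact: (measurableT_comp measurable_log1 measurable_fst).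
    - exact: (measurableT_comp measurable_log1 measurable_snd).
  by move=> q; rewrite lee_fin addr_ge0// log1_ge0.
move=> z fin_z; rewrite /F/= potential_split//.
by rewrite addeAC subee ?add0e// log1_mass_fin.
Qed.

Definition reg_mass r z : \bar R := \int[sigma]_t (log_kernel r (z - (t : R[i])))%:E.

Lemma measurable_log_kernel_sub r z :
  measurable_fun setT (fun t : borelC R => (log_kernel r (z - (t : R[i])))%:E).
Proof.
apply/measurable_EFinP; apply: (measurableT_comp (measurable_log_kernel r)).
exact: (measurableT_comp measurable_subC (pair1_measurable (z : borelC R))).
Qed.

Lemma integrable_log_kernel r z : (0 < r)%R ->
  sigma.-integrable setT (fun t : borelC R => (log_kernel r (z - (t : R[i])))%:E).
Proof.
move=> r0; apply: le_integrable (integrable_log1 (ln (1 + modulus z + r) - ln r)) => //.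
- exact: measurable_log_kernel_sub.
- move=> t _; rewrite gee0_abs ?lee_fin ?log_kernel_ge0//.
  by apply: le_trans (log_kernel_log1 z (t : R[i]) r0) (ler_norm _).
Qed.

Lemma reg_mass_fin r z : (0 < r)%R -> reg_mass r z \is a fin_num.
Proof. by move=> r0; exact: integrable_fin_num (integrable_log_kernel z r0). Qed.

Lemma reg_mass_ge0 r z : (0 < r)%R -> 0 <= reg_mass r z.
Proof. by move=> r0; apply: integral_ge0 => t _; rewrite lee_fin log_kernel_ge0. Qed.

Lemma measurable_reg_mass r : (0 < r)%R -> measurable_fun setT (reg_mass r : borelC R -> _).
Proof.
move=> r0; apply: (measurable_fun_fubini_tonelli_F (fun q : borelC R * borelC R =>
  (log_kernel r ((q.1 : R[i]) - q.2))%:E)).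
- apply/measurable_EFinP.
  exact: (measurableT_comp (measurable_log_kernel r) measurable_subC).
- by move=> q; rewrite lee_fin log_kernel_ge0.
Qed.

Definition deficit_mass r z : \bar R := \int[sigma]_t (deficit r (z - (t : R[i])))%:E.

Lemma measurable_deficit_sub2 r : (0 < r)%R -> measurable_fun setT
  (fun q : borelC R * borelC R => (deficit r ((q.1 : R[i]) - q.2))%:E).
Proof.
move=> r0; apply/measurable_EFinP.
exact: (measurableT_comp (measurable_deficit r0) measurable_subC).
Qed.

Lemma measurable_deficit_sub r z : (0 < r)%R ->
  measurable_fun setT (fun t : borelC R => (deficit r (z - (t : R[i])))%:E).
Proof.
move=> r0.
exact: (measurableT_comp (measurable_deficit_sub2 r0) (pair1_measurable (z : borelC R))).
Qed.

Lemma deficit_mass_ge0 r z : (0 < r)%R -> 0 <= deficit_mass r z.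
Proof. by move=> r0; apply: integral_ge0 => t _; rewrite lee_fin deficit_ge0. Qed.

Lemma deficit_mass_fin r z : (0 < r)%R -> deficit_mass r z \is a fin_num.
Proof.
move=> r0; rewrite ge0_fin_numE ?deficit_mass_ge0//.
apply: (@le_lt_trans _ _ (\int[sigma]_t (cst (ln 5)%:E t))).
  apply: ge0_le_integral => //.
  - by move=> t _; rewrite lee_fin deficit_ge0.
  - exact: measurable_deficit_sub.
  - by move=> t _; rewrite lee_fin deficit_le.
rewrite integral_cst// lte_mul_pinfty//; first by rewrite lee_fin ln_ge0// ler1n.
exact: fin_num_fun_lty.
Qed.

Lemma measurable_deficit_mass r : (0 < r)%R ->
  measurable_fun setT (deficit_mass r : borelC R -> _).
Proof.
move=> r0; apply: (measurable_fun_fubini_tonelli_F (fun q : borelC R * borelC R =>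
  (deficit r ((q.1 : R[i]) - q.2))%:E)); first exact: measurable_deficit_sub2.
by move=> q; rewrite lee_fin deficit_ge0.
Qed.

Lemma reg_mass_mean r z : (0 < r)%R ->
  \int[@circle_prob R]_x reg_mass r (z + (2 * r)%:C%C * unit_circle x)%R =
  reg_mass r z + deficit_mass r z.
Proof.
move=> r0; rewrite /reg_mass.
rewrite (fubini_tonelli
  (m1 := @circle_prob R)
  (m2 := sigma)
  (fun q : measurableTypeR R * borelC R =>
    (log_kernel r (z + (2 * r)%:C%C * unit_circle q.1 - (q.2 : R[i])))%:E)).
- rewrite /deficit_mass -ge0_integralD//.
  + apply: eq_integral => t _; rewrite -deficitE//; apply: eq_integral => x _.
    by rewrite /= addrAC.
  + by move=> t _; rewrite lee_fin log_kernel_ge0.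
  + exact: measurable_log_kernel_sub.
  + by move=> t _; rewrite lee_fin deficit_ge0.
  + exact: measurable_deficit_sub.
- apply/measurable_EFinP.
  exact: (measurableT_comp (measurable_log_kernel r) (measurable_subC_circle z _)).
- by move=> q; rewrite lee_fin log_kernel_ge0.
Qed.

(** The potential of sigma for the kernel - log(max(|z - t|, r)). *)
Definition reg_potential r z : R :=
  (- fine (reg_mass r z) - ln r * fine (sigma setT))%R.

(** Averaging the logarithm over a circle of radius r truncates it at radius r, by
[log_circleE]. The constant log1_mass makes the integrand nonnegative, so that
Tonelli applies and the means of two potentials can be compared. *)
Lemma potential_circle_mean r z : (0 < r)%R ->
  (forall x, log_potential sigma (z + r%:C%C * unit_circle x)%R \is a fin_num) ->
  [/\ measurable_fun setT (fun x : R => log1_mass (ln (1 + (modulus z + r))) +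
        log_potential sigma (z + r%:C%C * unit_circle x)%R),
      forall x, 0 <= log1_mass (ln (1 + (modulus z + r))) +
        log_potential sigma (z + r%:C%C * unit_circle x)%R &
      \int[@circle_prob R]_x (log1_mass (ln (1 + (modulus z + r))) +
        log_potential sigma (z + r%:C%C * unit_circle x)%R) =
      log1_mass (ln (1 + (modulus z + r))) + (reg_potential r z)%:E].
Proof.
move=> r0 fin_circle; set s := (modulus z + r)%R; have z0 := modulus_ge0 z.
pose H (t : R[i]) : R := (ln (1 + s) + ln (1 + modulus t))%R.
pose F (q : measurableTypeR R * borelC R) : \bar R :=
  (H q.2)%:E - lne (modulus (z + r%:C%C * unit_circle q.1 - (q.2 : R[i])))%:E.
have zs x : (modulus (z + r%:C%C * unit_circle x) <= s)%R.
  by apply: modulus_shifted_circle_le; exact: ltW.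
have mF : measurable_fun setT F.
  apply: emeasurable_funB.
    apply/measurable_EFinP; apply: measurable_funD => //.
    exact: (measurableT_comp measurable_log1 measurable_snd).
  apply: measurable_lne.
  exact: (measurableT_comp measurable_modulus (measurable_subC_circle z r)).
have F0 q : 0 <= F q by rewrite sube_ge0 ?lne_sub_le ?orbT.
have FE x : \int[sigma]_t F (x, t) =
    log1_mass (ln (1 + s)) + log_potential sigma (z + r%:C%C * unit_circle x)%R.
  by rewrite -potential_split.
under [X in measurable_fun _ X]eq_fun do rewrite -FE.
under [X in X = _]eq_integral do rewrite -FE.
split.
- exact: (measurable_fun_fubini_tonelli_F F mF F0).
- by move=> x; rewrite -FE; exact: integral_ge0.
rewrite (fubini_tonelli
  (m1 := @circle_prob R)
  (m2 := sigma) F mF F0).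
have -> : \int[sigma]_t \int[@circle_prob R]_x F (x, t) =
    \int[sigma]_t ((H t)%:E - ((ln r)%:E + (log_kernel r (z - (t : R[i])))%:E)).
  apply: eq_integral => t _.
  have -> : (H t)%:E - ((ln r)%:E + (log_kernel r (z - (t : R[i])))%:E) =
      (H t - ln (Num.max (modulus (z - (t : R[i]))) r))%:E.
    by rewrite -[(_ + _)%E in X in _ - X]EFinD -EFinB; congr EFin; rewrite /log_kernel; lra.
  rewrite -log_circleE//.
    by apply: eq_integral => x _; rewrite /F/= addrAC.
  have t0 := modulus_ge0 (t : R[i]).
  rewrite /H expRD !lnK ?posrE /s; [|lra..].
  have := modulusD z (- (t : R[i]))%R; rewrite modulusN.
  have : (0 <= (modulus z + r) * modulus (t : R[i]))%R by rewrite mulr_ge0//; lra.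
  by lra.
have icst : sigma.-integrable setT (fun _ : borelC R => (ln r)%:E).
  exact: finite_measure_integrable_cst.
rewrite integralB//; last 2 first.
- exact: integrable_log1.
- by apply: integrableD => //; exact: integrable_log_kernel.
congr (_ + _); rewrite integralD//; last exact: integrable_log_kernel.
rewrite (integral_cst sigma measurableT) -/(reg_mass r z) /reg_potential.
have fm : sigma setT \is a fin_num by exact: fin_num_measure.
transitivity (- ((ln r)%:E * (fine (sigma setT))%:E + (fine (reg_mass r z))%:E)).
  by congr (- (_ * _ + _)); apply/esym/fineK => //; exact: reg_mass_fin.
by rewrite -EFinM -EFinD -EFinN; congr EFin; rewrite opprD addrC.
Qed.

End Potentials.

(** * The inequality for the exponential of the regularized difference *)

Section Regularization.
Context {R : realType}.
Implicit Types sigma : {finite_measure set (borelC R) -> \bar R}.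
Implicit Types (r k c : R) (z p t : R[i]).

Lemma log1_mass_ge0 sigma k : (0 <= k)%R -> 0 <= log1_mass sigma k.
Proof. by move=> k0; apply: integral_ge0 => t _; rewrite lee_fin addr_ge0// log1_ge0. Qed.

Lemma circle_integralD_cst (f : R -> \bar R) (a : \bar R) :
  measurable_fun setT f -> (forall x, 0 <= f x) -> 0 <= a ->
  \int[@circle_prob R]_x (f x + a) = \int[@circle_prob R]_x f x + a.
Proof. by move=> mf f0 a0; rewrite ge0_integralD// circle_integral_cst. Qed.

(** Integrate the inequality between the potentials over the circle. *)
Lemma reg_potential_le (mu nu : {finite_measure set (borelC R) -> \bar R}) r c z :
  integrates_log_at_infinity mu -> integrates_log_at_infinity nu -> (0 < r)%R ->
  (forall x, log_potential mu (z + r%:C%C * unit_circle x)%R \is a fin_num) ->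
  (forall x, log_potential nu (z + r%:C%C * unit_circle x)%R \is a fin_num) ->
  (forall x, log_potential mu (z + r%:C%C * unit_circle x)%R <=
    log_potential nu (z + r%:C%C * unit_circle x)%R + c%:E) ->
  (reg_potential mu r z <= reg_potential nu r z + c)%R.
Proof.
move=> mul nul r0 mufin nufin le_mu_nu.
have [mmu mu0 muE] := potential_circle_mean mul r0 mufin.
have [mnu nu0 nuE] := potential_circle_mean nul r0 nufin.
have s0 := modulus_ge0 z.
set k := ln (1 + (modulus z + r))%R in mmu mu0 muE mnu nu0 nuE.
have k0 : (0 <= k)%R by rewrite ln_ge0//; lra.
have Mf := log1_mass_fin mul k; have Nf := log1_mass_fin nul k.
have M0 := log1_mass_ge0 mu k0; have N0 := log1_mass_ge0 nu k0.
set M := log1_mass mu k in mmu mu0 muE Mf M0.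
set N := log1_mass nu k in mnu nu0 nuE Nf N0.
clearbody M N.
(* Adding N + |c| on one side and M + |c| on the other keeps both integrands
   nonnegative. *)
have cc : (0 <= `|c| + c)%R by have := ler_norm (- c); rewrite normrN; lra.
have : \int[@circle_prob R]_x ((M + log_potential mu (z + r%:C%C * unit_circle x)%R)
      + (N + `|c|%:E)) <=
    \int[@circle_prob R]_x ((N + log_potential nu (z + r%:C%C * unit_circle x)%R)
      + (M + (`|c| + c)%:E)).
  apply: ge0_le_integral => //.
  - by move=> x _; apply: adde_ge0 => //; rewrite adde_ge0 ?lee_fin.
  - exact: emeasurable_funD.
  - exact: emeasurable_funD.
  - move=> x _; move: (mufin x) (nufin x) (le_mu_nu x) Mf Nf.
    case: (log_potential mu _) => [a| |]//; case: (log_potential nu _) => [b| |]// _ _.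
    move: M N {mmu mu0 muE mnu nu0 nuE M0 N0} => [m| |]// [n| |]// + _ _.
    by rewrite !lee_fin; lra.
rewrite (circle_integralD_cst mmu mu0) ?adde_ge0 ?lee_fin//.
rewrite (circle_integralD_cst mnu nu0) ?adde_ge0 ?lee_fin// muE nuE.
by move: M N Mf Nf {mmu mu0 muE mnu nu0 nuE M0 N0 s0} => [m| |]// [n| |]// _ _; rewrite !lee_fin; lra.
Qed.

Definition exp_reg (mu nu : {finite_measure set (borelC R) -> \bar R}) r c k p : R :=
  expR (k * (reg_potential mu r p - reg_potential nu r p - c)).

Lemma measurable_exp_reg mu nu r c k : (0 < r)%R ->
  measurable_fun setT (exp_reg mu nu r c k : borelC R -> R).
Proof.
move=> r0; apply: measurableT_comp => //.
apply: measurable_funM => //; apply: measurable_funB => //.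
apply: measurable_funB; apply: measurable_funB => //; apply: measurable_funN.
- exact: (measurableT_comp (fine_measurable measurableT) (measurable_reg_mass mu r0)).
- exact: (measurableT_comp (fine_measurable measurableT) (measurable_reg_mass nu r0)).
Qed.

(** Convexity in the form exp(k w') >= exp(k w) (1 + k (w' - w)), averaged over w'
on the circle: the mean of w' - w is the deficit mass of nu minus that of mu. The
two sides are arranged so that every term is nonnegative. *)
Lemma exp_reg_potential_mean (mu nu : {finite_measure set (borelC R) -> \bar R}) r c k z :
  integrates_log_at_infinity mu -> integrates_log_at_infinity nu ->
  (0 < r)%R -> (0 <= k)%R ->
  (exp_reg mu nu r c k z)%:E + (k * exp_reg mu nu r c k z)%:E * deficit_mass nu r z <=
  \int[@circle_prob R]_x (exp_reg mu nu r c k (z + (2 * r)%:C%C * unit_circle x)%R)%:E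
    + (k * exp_reg mu nu r c k z)%:E * deficit_mass mu r z.
Proof.
move=> mul nul r0 k0; set f := exp_reg mu nu r c k.
have Mf p := reg_mass_fin mul p r0; have Nf p := reg_mass_fin nul p r0.
have M0 p := reg_mass_ge0 mu p r0; have N0 p := reg_mass_ge0 nu p r0.
have f0 p : (0 <= f p)%R by exact: expR_ge0.
have kf0 : (0 <= k * f z)%R by rewrite mulr_ge0.
pose e x := (z + (2 * r)%:C%C * unit_circle x)%R.
have me : measurable_fun setT (e : measurableTypeR R -> borelC R).
  exact: (measurableT_comp (measurable_addC_circle (2 * r)%R)
    (measurable_fun_pair (measurable_cst (z : borelC R)) (@measurable_id _ _ setT))).
have mM : measurable_fun setT (fun x => reg_mass mu r (e x)).
  exact: (measurableT_comp (measurable_reg_mass mu r0) me).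
have mN : measurable_fun setT (fun x => reg_mass nu r (e x)).
  exact: (measurableT_comp (measurable_reg_mass nu r0) me).
have mf : measurable_fun setT (fun x => (f (e x))%:E).
  by apply/measurable_EFinP; exact: (measurableT_comp (measurable_exp_reg mu nu c k r0) me).
have : \int[@circle_prob R]_x (((f z)%:E + (k * f z)%:E * reg_mass mu r z)
      + (k * f z)%:E * reg_mass nu r (e x)) <=
    \int[@circle_prob R]_x (((f (e x))%:E + (k * f z)%:E * reg_mass nu r z)
      + (k * f z)%:E * reg_mass mu r (e x)).
  apply: ge0_le_integral => //.
  - by move=> x _; rewrite !adde_ge0 ?mule_ge0 ?lee_fin.
  - by apply: emeasurable_funD => //; exact: measurable_funeM.
  - by apply: emeasurable_funD; [apply: emeasurable_funD|exact: measurable_funeM].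
  - move=> x _; rewrite -(fineK (Mf z)) -(fineK (Mf (e x))) -(fineK (Nf z)) -(fineK (Nf (e x))).
    rewrite -!EFinM -!EFinD lee_fin.
    set w := (k * (reg_potential mu r z - reg_potential nu r z - c))%R.
    set w' := (k * (reg_potential mu r (e x) - reg_potential nu r (e x) - c))%R.
    have : (f z * (1 + (w' - w)) <= f (e x))%R.
      rewrite /f /exp_reg -/w -/w' -[X in (_ <= expR X)%R](subrKC w) expRD ler_wpM2l ?expR_ge0//.
      exact: expR_ge1Dx.
    rewrite /w /w' /reg_potential.
    set a := fine (reg_mass mu r z); set b := fine (reg_mass nu r z).
    set a' := fine (reg_mass mu r (e x)); set b' := fine (reg_mass nu r (e x)).
    by lra.
rewrite ge0_integralD//; last 3 first.
- by move=> x _; rewrite adde_ge0 ?mule_ge0 ?lee_fin.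
- by move=> x _; rewrite mule_ge0 ?lee_fin.
- exact: measurable_funeM.
rewrite circle_integral_cst ge0_integralZl// reg_mass_mean//.
rewrite ge0_integralD//; last 4 first.
- by move=> x _; rewrite adde_ge0 ?mule_ge0 ?lee_fin.
- exact: emeasurable_funD.
- by move=> x _; rewrite mule_ge0 ?lee_fin.
- exact: measurable_funeM.
rewrite ge0_integralD//; last 2 first.
- by move=> x _; rewrite lee_fin.
- by move=> x _; rewrite mule_ge0 ?lee_fin.
rewrite circle_integral_cst ge0_integralZl// reg_mass_mean//.
set I := \int[circle_prob]_x _.
have := deficit_mass_fin mu z r0; have := deficit_mass_fin nu z r0.
have : 0 <= I by apply: integral_ge0 => x _; rewrite lee_fin.
move: (reg_mass mu r z) (Mf z) (reg_mass nu r z) (Nf z) => [u| |]// _ [v| |]// _.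
case: (deficit_mass mu r z) => [du| |]//; case: (deficit_mass nu r z) => [dv| |]//.
case: I => [i| |]// _ _ _.
  by rewrite !lee_fin; lra.
by move=> _; rewrite addye// leey.
Qed.

End Regularization.

(** * Convergence of the regularized potentials *)

Section RegularizationLimit.
Context {R : realType}.
Variable sigma : {finite_measure set (borelC R) -> \bar R}.
Hypothesis sigma_log : integrates_log_at_infinity sigma.
Implicit Types (r : R) (z t s : R[i]).

Lemma reg_potentialE r z : (0 < r)%R ->
  (reg_potential sigma r z)%:E =
  - \int[sigma]_s (ln (Num.max (modulus (z - (s : R[i]))) r))%:E.
Proof.
move=> r0.
have -> : \int[sigma]_s (ln (Num.max (modulus (z - (s : R[i]))) r))%:E =
    \int[sigma]_s ((log_kernel r (z - (s : R[i])))%:E + (ln r)%:E).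
  by apply: eq_integral => s _; rewrite -EFinD subrK.
rewrite integralD//; [|exact: integrable_log_kernel|exact: finite_measure_integrable_cst].
rewrite (integral_cst sigma measurableT) -/(reg_mass sigma r z) /reg_potential.
have fm : sigma setT \is a fin_num by exact: fin_num_measure.
transitivity (- ((fine (reg_mass sigma r z))%:E + (ln r)%:E * (fine (sigma setT))%:E)).
  by rewrite -EFinM -EFinD -EFinN; congr EFin; rewrite opprD.
by congr (- (_ + _ * _)); apply: fineK => //; exact: reg_mass_fin.
Qed.

(** A finite potential excludes a point mass at t, so that [ln], for which
ln 0 = 0, may replace [lne] almost everywhere. *)
Lemma integrable_ln_sub t : log_potential sigma t \is a fin_num ->
  [/\ sigma.-integrable setT (fun s : borelC R => (ln (modulus (t - (s : R[i]))))%:E),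
      log_potential sigma t = - \int[sigma]_s (ln (modulus (t - (s : R[i]))))%:E &
      {ae sigma, forall s : borelC R, (0 < modulus (t - (s : R[i])))%R}].
Proof.
move=> /(integrable_potential sigma_log) intl.
have ml : measurable_fun setT (fun s : borelC R => (ln (modulus (t - (s : R[i]))))%:E).
  apply/measurable_EFinP; apply: measurableT_comp => //.
  apply: (measurableT_comp measurable_modulus).
  exact: (measurableT_comp measurable_subC (pair1_measurable (t : borelC R))).
have ae0 : {ae sigma, forall s : borelC R, (0 < modulus (t - (s : R[i])))%R}.
  have := integrable_ae measurableT intl; apply: filterS => s /(_ I).
  by rewrite /=; case: ifPn => //; rewrite -ltNge.
have lneE (s : R[i]) : (0 < modulus (t - s))%R ->
    lne (modulus (t - s))%:E = (ln (modulus (t - s)))%:E by exact: lne_EFin.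
split => //.
- apply: le_integrable intl => // s _ /=.
  by have [ts|ts] := leP (modulus (t - s)) 0%R => //; rewrite leey.
- rewrite /log_potential; congr (- _); apply: ae_eq_integral => //.
    exact: measurable_lne_sub.
  by move: ae0; apply: filterS => s ts _; exact: lneE.
Qed.

(** Both arguments of the logarithms lie within 3 r of each other; the factor 12
absorbs the case where the larger one is |t - s|, since then |t - s| <= 4 m for
the truncated modulus m >= r. *)
Lemma ln_max_close r t z s : (0 < r)%R -> (modulus (t - z) < 3 * r)%R ->
  (0 < modulus (t - s))%R ->
  (`|ln (Num.max (modulus (z - s)) r) - ln (modulus (t - s))| <=
   ln (1 + 12 * r / modulus (t - s)))%R.
Proof.
move=> r0 tz d0; set m := Num.max _ _; set d := modulus _ in d0 *.
have rm : (r <= m)%R by rewrite le_max lexx orbT.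
have m0 : (0 < m)%R by exact: lt_le_trans rm.
have dm : (d <= m + 3 * r)%R.
  have := modulus_triangle z t s; rewrite -/d.
  have : (modulus (z - s) <= m)%R by rewrite le_max lexx.
  by lra.
have md : (m <= d + 3 * r)%R.
  rewrite ge_max; apply/andP; split; last by lra.
  by have := modulus_triangle t z s; rewrite (modulusB z t) -/d; lra.
have q0 : (0 < 12 * r / d)%R by rewrite divr_gt0// mulr_gt0.
have qd : (d * (12 * r / d) = 12 * r)%R by rewrite mulrCA divff ?mulr1// gt_eqF.
rewrite ler_norml; apply/andP; split.
- suff : (ln d <= ln (m * (1 + 12 * r / d)))%R by rewrite lnM ?posrE ?addr_gt0//; lra.
  rewrite ler_ln ?posrE ?mulr_gt0 ?addr_gt0//.
  have [|md'] := leP d m; first by move=> dm'; apply: le_trans dm' _; rewrite ler_peMr ?ltW//; lra.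
  have h : (3 * r <= m * (12 * r / d))%R.
    rewrite mulrA ler_pdivlMr//.
    have : (r * d <= r * (4 * m))%R by rewrite ler_pM2l//; lra.
    by lra.
  by rewrite mulrDr mulr1; lra.
- suff : (ln m <= ln (d * (1 + 12 * r / d)))%R by rewrite lnM ?posrE ?addr_gt0//; lra.
  rewrite ler_ln ?posrE ?mulr_gt0 ?addr_gt0//.
  by rewrite mulrDr mulr1 qd; lra.
Qed.

(** By [ln_max_close] the integrands differ by at most log(1 + 12 r / |t - s|). This
bound does not involve z; it tends to 0 with r, and it is dominated for r <= 1 by
an integrable function because the potential is finite at t. *)
Lemma reg_potential_cvg t (eps : R) : log_potential sigma t \is a fin_num -> (0 < eps)%R ->
  exists2 delta : R, (0 < delta)%R & forall r, (0 < r < delta)%R ->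
    forall z, (modulus (t - z) < 3 * r)%R ->
    (`|reg_potential sigma r z - fine (log_potential sigma t)| <= eps)%R.
Proof.
move=> fin_t eps0; have [intl VE ae0] := integrable_ln_sub fin_t.
pose D (s : borelC R) := modulus (t - (s : R[i])).
have mD : measurable_fun setT D.
  apply: (measurableT_comp measurable_modulus).
  exact: (measurableT_comp measurable_subC (pair1_measurable (t : borelC R))).
have D0 s : (0 <= D s)%R by exact: modulus_ge0.
pose B (r : R) (s : borelC R) : R := ln (1 + 12 * r / D s).
have mB r : measurable_fun setT (B r).
  apply: measurableT_comp => //; apply: measurable_funD => //.
  apply: measurable_funM => //.
  under [X in measurable_fun _ X]eq_fun do rewrite -powR_inv1//.
  exact: (measurableT_comp (@measurable_powR R (-1)%R) mD).
have B0 r s : (0 <= r)%R -> (0 <= B r s)%R.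
  by move=> r0; rewrite ln_ge0// lerDl divr_ge0// mulr_ge0.
(* log(1 + 12 r / d) = log(d + 12 r) - log d with d + 12 r <= 13 (1 + |t|) (1 + |s|). *)
pose G (s : borelC R) : R :=
  ((ln 13 + ln (1 + modulus t) + ln (1 + modulus (s : R[i]))) + `|ln (D s)|)%R.
have BG r s : (0 <= r <= 1)%R -> (B r s <= G s)%R.
  move=> /andP[r0 r1]; have t0 := modulus_ge0 t; have s0 := modulus_ge0 (s : R[i]).
  have l13 : (0 <= ln 13 :> R)%R by rewrite ln_ge0// ler1n.
  have [Ds|Ds] := leP (D s) 0%R.
    have -> : B r s = 0%R.
      by rewrite /B (_ : D s = 0%R) ?invr0 ?mulr0 ?addr0 ?ln1//; apply/eqP; rewrite eq_le Ds D0.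
    by rewrite /G !addr_ge0// log1_ge0.
  have -> : B r s = (ln (D s + 12 * r) - ln (D s))%R.
    rewrite -ln_div ?posrE ?ltr_wpDr// ?mulr_ge0//.
    by rewrite mulrDl divff ?gt_eqF.
  apply: lerD; last by rewrite (le_trans (ler_norm _))// normrN.
  rewrite -!lnM ?posrE ?mulr_gt0 ?ltr_wpDr// ler_ln ?posrE ?mulr_gt0 ?ltr_wpDr ?mulr_ge0//.
  have : (D s <= modulus t + modulus (s : R[i]))%R.
    by apply: le_trans (modulusD _ _) _; rewrite modulusN.
  have : (0 <= modulus t * modulus (s : R[i]))%R by rewrite mulr_ge0.
  by lra.
have intG : sigma.-integrable setT (EFin \o G).
  pose G1 (s : borelC R) :=
    ((ln 13 + ln (1 + modulus t)) + ln (1 + modulus (s : R[i])))%:E.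
  have -> : EFin \o G = G1 \+ (EFin \o (fun s => `|ln (D s)|%R)) by [].
  apply: integrableD => //; first exact: integrable_log1.
  exact: integrable_norm.
have Bcvg : \int[sigma]_s (B (harmonic n) s)%:E @[n --> \oo] --> 0.
  have -> : 0 = \int[sigma]_(s in setT) (cst 0) s by rewrite integral_cst// mul0e.
  apply: (@dominated_cvg _ _ _ sigma setT measurableT _ _ (EFin \o G)).
  - by move=> n; exact/measurable_EFinP.
  - move=> s _; apply: cvg_EFin; first exact: nearW.
    rewrite /B -[X in _ --> X](@ln1 R).
    apply: continuous_cvg; first exact: continuous_ln.
    rewrite -[X in _ --> X]addr0; apply: cvgD; first exact: cvg_cst.
    rewrite -[X in _ --> X](mul0r (D s)^-1%R) -(mulr0 12%R).
    apply: cvgM; last exact: cvg_cst.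
    by apply: cvgM; [exact: cvg_cst|exact: cvg_harmonic].
  - by [].
  - exact: intG.
  - move=> n s _; have h0 : (0 <= harmonic n :> R)%R by rewrite ltW// harmonic_gt0.
    rewrite /= lee_fin ger0_norm ?B0// BG// h0/=.
    by rewrite invf_le1// ler1n.
have [n _ /(_ n (leqnn _)) Bn] : \forall n \near \oo,
    \int[sigma]_s (B (harmonic n) s)%:E < eps%:E.
  have /fine_cvgP[Bfin Blim] := Bcvg; near=> n.
  rewrite -[X in X < _]fineK; last by near: n.
  by rewrite lte_fin; near: n; exact: (cvgr_lt 0%R).
exists (harmonic n); first exact: harmonic_gt0.
move=> r /andP[r0 rn] z tz.
rewrite -lee_fin; apply: le_trans (ltW Bn).
have mmax : measurable_fun setT
    (fun s : borelC R => (ln (Num.max (modulus (z - (s : R[i]))) r))%:E).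
  apply/measurable_EFinP; apply: measurableT_comp => //.
  apply: measurable_maxr => //; apply: (measurableT_comp measurable_modulus).
  exact: (measurableT_comp measurable_subC (pair1_measurable (z : borelC R))).
have intm : sigma.-integrable setT
    (fun s : borelC R => (ln (Num.max (modulus (z - (s : R[i]))) r))%:E).
  apply: (@eq_integrable _ _ _ _ _ measurableT
    (fun s : borelC R => (log_kernel r (z - (s : R[i])))%:E + (ln r)%:E)).
    by move=> s _; rewrite -EFinD subrK.
  by apply: integrableD => //; [exact: integrable_log_kernel|exact: finite_measure_integrable_cst].
have -> : `|reg_potential sigma r z - fine (log_potential sigma t)|%:E =
    `|\int[sigma]_s ((ln (Num.max (modulus (z - (s : R[i]))) r))%:E - (ln (D s))%:E)|.
  rewrite integralB// -[X in X - _]oppeK -reg_potentialE//.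
  rewrite -[X in _ - X]oppeK -VE -(fineK fin_t) -!EFinN -EFinB /= opprK.
  by congr EFin; rewrite -normrN opprB addrC.
apply: le_trans (le_abse_integral _ _ _) _ => //.
  by apply: emeasurable_funB => //; exact: (measurable_int sigma).
apply: ae_ge0_le_integral => //.
- by apply: measurableT_comp => //; apply: emeasurable_funB => //; exact: (measurable_int sigma).
- by move=> s _; rewrite lee_fin B0// ltW// harmonic_gt0.
- exact/measurable_EFinP.
move: ae0; apply: filterS => s ds _.
rewrite -EFinB lee_fin; apply: le_trans (ln_max_close r0 tz ds) _.
have q0 a : (0 <= a)%R -> (0 < 1 + 12 * a / D s)%R.
  by move=> a0; rewrite ltr_wpDr// divr_ge0// mulr_ge0.
rewrite /B ler_ln ?posrE ?q0 ?(ltW r0) ?harmonic_ge0//.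
by rewrite lerD2l ler_pM2r ?invr_gt0// ler_pM2l// ltW.
Unshelve. all: end_near. Qed.

End RegularizationLimit.

(** * The comparison against a test function *)

Section BoundedConvergence.
Context d (T : measurableType d) {R : realType}.

Lemma bounded_cvg_integral (sigma : {finite_measure set T -> \bar R})
    (g : nat -> T -> R) (G : T -> R) :
  (forall n, measurable_fun setT (g n)) -> (forall n t, (0 <= g n t <= 1)%R) ->
  (forall t, g n t @[n --> \oo] --> G t) ->
  \int[sigma]_t (g n t)%:E @[n --> \oo] --> \int[sigma]_t (G t)%:E.
Proof.
move=> mg g01 gG.
apply: (@dominated_cvg _ _ _ sigma setT measurableT _ _ (EFin \o cst 1%R)) => //.
- by move=> n; exact/measurable_EFinP.
- by move=> t _; apply: cvg_EFin; [exact: nearW|exact: gG].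
- exact: finite_measure_integrable_cst.
- by move=> n t _; rewrite /= lee_fin ger0_norm; case/andP: (g01 n t).
Qed.

Lemma bounded_cvg_integral_le (mu nu : {finite_measure set T -> \bar R})
    (g : nat -> T -> R) (G : T -> R) (a_ : nat -> R) (a : R) :
  (forall n, measurable_fun setT (g n)) -> (forall n t, (0 <= g n t <= 1)%R) ->
  (forall t, g n t @[n --> \oo] --> G t) -> a_ n @[n --> \oo] --> a ->
  (forall n, \int[nu]_t (g n t)%:E <= \int[mu]_t (g n t)%:E + (a_ n)%:E) ->
  \int[nu]_t (G t)%:E <= \int[mu]_t (G t)%:E + a%:E.
Proof.
move=> mg g01 gG aa le_g.
have cnu := bounded_cvg_integral (sigma := nu) mg g01 gG.
have cmu : \int[mu]_t (g n t)%:E + (a_ n)%:E @[n --> \oo] -->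
    \int[mu]_t (G t)%:E + a%:E.
  apply: cvgeD; first by rewrite fin_num_adde_defl.
  - exact: bounded_cvg_integral.
  - by apply: cvg_EFin => //; exact: nearW.
rewrite -(cvg_lim _ cnu)// -(cvg_lim _ cmu)//.
apply: lee_lim; first by apply/cvg_ex; exists (\int[nu]_t (G t)%:E).
- by apply/cvg_ex; exists (\int[mu]_t (G t)%:E + a%:E).
- exact: nearW.
Qed.

End BoundedConvergence.

Section DeficitTotal.
Context {R : realType}.
Implicit Types (r : R) (t : R[i]).

(** The normalization that turns the deficit into an approximate identity. *)
Definition deficit_total r : \bar R := \int[@plane_measure R]_z (deficit r (z : R[i]))%:E.

Let plane_measure_indic t r : plane_measure (disc t r) =
  \int[@plane_measure R]_z (\1_(disc t r : set (borelC R)) z)%:E.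
Proof. by rewrite integral_indic ?setIT//; exact: measurable_disc. Qed.

Lemma deficit_total_ge0 r : (0 < r)%R -> 0 <= deficit_total r.
Proof. by move=> r0; apply: integral_ge0 => z _; rewrite lee_fin deficit_ge0. Qed.

(** The order r^2 matches the error C r^2 in the means of a test function. *)
Lemma deficit_total_ge r : (0 < r)%R -> (ln 2 * (r / 4) ^+ 2)%:E <= deficit_total r.
Proof.
move=> r0; have l2 : (0 <= ln 2 :> R)%R by rewrite ln_ge0// ler1n.
apply: (@le_trans _ _ ((ln 2)%:E * plane_measure (disc (0%R : R[i]) r))).
  by rewrite EFinM lee_wpmul2l ?lee_fin// plane_measure_disc_ge// ltW.
rewrite plane_measure_indic -ge0_integralZl//.
- apply: ge0_le_integral => //.
  + by move=> z _; rewrite mule_ge0 ?lee_fin.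
  + apply: measurable_funeM; apply/measurable_EFinP; apply: measurable_indic.
    exact: measurable_disc.
  + by apply/measurable_EFinP; exact: measurable_deficit.
  + move=> z _; rewrite indicE; have [|] := boolP (z \in _).
      rewrite inE /disc/= sub0r modulusN => zr.
      by rewrite mule1 lee_fin deficit_near// ltW.
    by rewrite mule0 lee_fin deficit_ge0.
- by apply/measurable_EFinP; apply: measurable_indic; exact: measurable_disc.
Qed.

Lemma deficit_total_fin r : (0 < r)%R -> deficit_total r \is a fin_num.
Proof.
move=> r0; have l5 : (0 <= ln 5 :> R)%R by rewrite ln_ge0// ler1n.
rewrite ge0_fin_numE; last by apply: integral_ge0 => z _; rewrite lee_fin deficit_ge0.
apply: (@le_lt_trans _ _ ((ln 5)%:E * plane_measure (disc (0%R : R[i]) (3 * r)))); last first.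
  by rewrite lte_mul_pinfty// plane_measure_disc_lty.
rewrite plane_measure_indic -ge0_integralZl//.
- apply: ge0_le_integral => //.
  + by move=> z _; rewrite lee_fin deficit_ge0.
  + by apply/measurable_EFinP; exact: measurable_deficit.
  + apply: measurable_funeM; apply/measurable_EFinP; apply: measurable_indic.
    exact: measurable_disc.
  + move=> z _; rewrite indicE; have [|] := boolP (z \in _).
      by rewrite mule1 lee_fin deficit_le.
    rewrite notin_setE /disc/= sub0r modulusN => /negP; rewrite -leNgt => zr.
    by rewrite mule0 lee_fin deficit_far.
- by apply/measurable_EFinP; apply: measurable_indic; exact: measurable_disc.
Qed.

Lemma deficit_total_shift r t : (0 < r)%R ->
  \int[@plane_measure R]_z (deficit r ((z : R[i]) - t)%R)%:E = deficit_total r.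
Proof.
move=> r0; apply: (@plane_integral_shift _ (- t)%R (fun z => (deficit r (z : R[i]))%:E)).
- by apply/measurable_EFinP; exact: measurable_deficit.
- by move=> z; rewrite lee_fin deficit_ge0.
Qed.

End DeficitTotal.

(** The one-sided bound on the circle means is all that the argument keeps of the
smoothness of a test function: it replaces an upper bound on its Laplacian. *)
Section TestFunction.
Context {R : realType}.
Variables mu nu : {finite_measure set (borelC R) -> \bar R}.
Hypothesis mu_log : integrates_log_at_infinity mu.
Hypothesis nu_log : integrates_log_at_infinity nu.
Variable Omega : set R[i].
Hypothesis mu_fin : forall z, Omega z -> log_potential mu z \is a fin_num.
Hypothesis nu_fin : forall z, Omega z -> log_potential nu z \is a fin_num.
Variable c : R.
Hypothesis le_pot : forall z, Omega z -> log_potential mu z <= log_potential nu z + c%:E.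
Variables (chi : borelC R -> R) (S eta C : R).
Hypothesis mchi : measurable_fun setT chi.
Hypothesis chi01 : forall z, (0 <= chi z <= 1)%R.
Hypothesis eta0 : (0 < eta)%R.
Hypothesis C0 : (0 <= C)%R.
Hypothesis chi_mean : forall (z : R[i]) (r : R), (0 < r)%R ->
  \int[@circle_prob R]_x (chi (z - r%:C%C * unit_circle x)%R)%:E <= (chi z + C * r ^+ 2)%:E.
Hypothesis chi_supp : forall z : R[i], chi z != 0%R -> (modulus z < S)%R /\
  forall w, (modulus (z - w) < eta)%R -> Omega w.
Hypothesis chi_cont : forall (t : R[i]) (eps : R), (0 < eps)%R -> exists2 delta : R, (0 < delta)%R &
  forall z : R[i], (modulus (t - z) < delta)%R -> (`|chi z - chi t| <= eps)%R.
Implicit Types (r k : R) (z t : R[i]).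

Let chi0 z : (0 <= chi z)%R. Proof. by case/andP: (chi01 z). Qed.
Let chi1 z : (chi z <= 1)%R. Proof. by case/andP: (chi01 z). Qed.

(** By [reg_potential_le] the regularized difference is nonpositive at z, whose circle
of radius r stays in the eta-neighbourhood of the support of chi. *)
Lemma exp_reg_le1 r k z z' : (0 < r)%R -> (3 * r < eta)%R -> (0 <= k)%R ->
  chi z' != 0%R -> (modulus (z' - z) <= 2 * r)%R -> (exp_reg mu nu r c k z <= 1)%R.
Proof.
move=> r0 r3 k0 chi_z' zz'.
have Om x : Omega (z + r%:C%C * unit_circle x)%R.
  have [_ +] := chi_supp chi_z'; apply.
  apply: le_lt_trans (modulus_triangle z _ _) _.
  rewrite opprD addNKr modulusN modulusM modulusC modulus_circle mulr1 gtr0_norm//.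
  by lra.
rewrite -[leRHS](@expR0 R) ler_expR mulr_ge0_le0//.
have := @reg_potential_le _ mu nu r c z mu_log nu_log r0 (fun x => mu_fin (Om x))
  (fun x => nu_fin (Om x)) (fun x => le_pot (Om x)).
by lra.
Qed.

Let area := fine (plane_measure (disc (0%R : R[i]) (S + 1))).

Let areaE : plane_measure (disc (0%R : R[i]) (S + 1)) = area%:E.
Proof. by rewrite fineK// ge0_fin_numE// plane_measure_disc_lty. Qed.

(** The smearing of chi exp(k w) by the deficit, as it comes out of Tonelli. *)
Definition smeared r k t : \bar R :=
  \int[@plane_measure R]_z (chi z * exp_reg mu nu r c k z * deficit r ((z : R[i]) - t))%:E.

Let chif r k (z : borelC R) : R := (chi z * exp_reg mu nu r c k z)%R.

Let mchif r k : (0 < r)%R -> measurable_fun setT (chif r k).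
Proof. by move=> r0; apply: measurable_funM => //; exact: measurable_exp_reg. Qed.

Let chif0 r k z : (0 <= chif r k z)%R.
Proof. by rewrite mulr_ge0// expR_ge0. Qed.

Let chif1 r k z : (0 < r)%R -> (3 * r < eta)%R -> (0 <= k)%R -> (chif r k z <= 1)%R.
Proof.
move=> r0 r3 k0; have [cz|cz] := eqVneq (chi z) 0%R; first by rewrite /chif cz mul0r.
rewrite -[leRHS]mulr1 ler_pM ?expR_ge0//.
by apply: (exp_reg_le1 r0 r3 k0 cz); rewrite subrr modulus0 mulr_ge0// ltW.
Qed.

Let smear r k (q : borelC R * borelC R) : \bar R :=
  (chif r k q.1 * deficit r ((q.1 : R[i]) - (q.2 : R[i])))%:E.

Let msmear r k : (0 < r)%R -> measurable_fun setT (smear r k).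
Proof.
move=> r0; apply/measurable_EFinP; apply: measurable_funM.
- exact: (measurableT_comp (mchif k r0) measurable_fst).
- exact: (measurableT_comp (measurable_deficit r0) measurable_subC).
Qed.

Let smear0 r k q : (0 < r)%R -> 0 <= smear r k q.
Proof. by move=> r0; rewrite lee_fin mulr_ge0// deficit_ge0. Qed.

Lemma measurable_smeared r k : (0 < r)%R -> measurable_fun setT (smeared r k : borelC R -> _).
Proof.
move=> r0; exact: (measurable_fun_fubini_tonelli_G (m1 := @plane_measure R) (smear r k)
  (msmear k r0) (fun q => smear0 k q r0)).
Qed.

Lemma smeared_ge0 r k t : (0 < r)%R -> 0 <= smeared r k t.
Proof.
move=> r0; apply: integral_ge0 => z _; exact: (smear0 k ((z : borelC R), (t : borelC R)) r0).
Qed.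

Lemma integral_smeared (sigma : {finite_measure set (borelC R) -> \bar R}) r k :
  (0 < r)%R -> (0 <= k)%R ->
  \int[@plane_measure R]_z ((k * chif r k z)%:E * deficit_mass sigma r z) =
  k%:E * \int[sigma]_t smeared r k t.
Proof.
move=> r0 k0.
have -> : \int[sigma]_t smeared r k t =
    \int[@plane_measure R]_z \int[sigma]_t smear r k (z, t).
  by rewrite (fubini_tonelli (m1 := @plane_measure R) (m2 := sigma) (smear r k)
    (msmear k r0) (fun q => smear0 k q r0)).
rewrite -(@ge0_integralZl _ _ _ (@plane_measure R) setT measurableT
  (fun z => \int[sigma]_t smear r k (z, t))).
- apply: eq_integral => z _; rewrite EFinM -muleA; congr (_ * _).
  rewrite /deficit_mass -ge0_integralZl//.
  + exact: measurable_deficit_sub.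
  + by move=> t _; rewrite lee_fin deficit_ge0.
  + by rewrite lee_fin.
- exact: (measurable_fun_fubini_tonelli_F (m2 := sigma) (smear r k)
    (msmear k r0) (fun q => smear0 k q r0)).
- by move=> z _; apply: integral_ge0 => t _; exact: smear0.
- by rewrite lee_fin.
Qed.

(** The circle mean is symmetric for the plane measure, so that it may be moved from
exp(k w) to chi. There it costs C (2 r)^2 exp(k w), and exp(k w) <= 1 where the
circle meets the support of chi. *)
Lemma mean_transfer r k : (0 < r)%R -> (3 * r < eta)%R -> (2 * r <= 1)%R -> (0 <= k)%R ->
  \int[@plane_measure R]_z ((chi z)%:E * \int[@circle_prob R]_x
      (exp_reg mu nu r c k ((z : R[i]) + (2 * r)%:C%C * unit_circle x)%R)%:E) <=
  \int[@plane_measure R]_z (chif r k z)%:E + (4 * C * r ^+ 2 * area)%:E.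
Proof.
move=> r0 r3 r2 k0; set f := exp_reg mu nu r c k.
have mf : measurable_fun setT (f : borelC R -> R) by exact: measurable_exp_reg.
have f0 z : (0 <= f z)%R by exact: expR_ge0.
pose s : R := (2 * r)%R.
have s0 : (0 < s)%R by rewrite mulr_gt0.
have msub : measurable_fun setT (fun q : borelC R * measurableTypeR R =>
    ((q.1 : R[i]) - s%:C%C * unit_circle q.2 : borelC R)%R).
  under eq_fun do rewrite -mulNr -rmorphN.
  exact: measurable_addC_circle.
pose F1 (q : borelC R * measurableTypeR R) : \bar R :=
  (chi q.1 * f ((q.1 : R[i]) + s%:C%C * unit_circle q.2)%R)%:E.
have mF1 : measurable_fun setT F1.
  apply/measurable_EFinP; apply: measurable_funM.
  - exact: (measurableT_comp mchi measurable_fst).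
  - exact: (measurableT_comp mf (measurable_addC_circle s)).
have F10 q : 0 <= F1 q by rewrite lee_fin mulr_ge0.
pose F2 (q : borelC R * measurableTypeR R) : \bar R :=
  (f q.1 * chi ((q.1 : R[i]) - s%:C%C * unit_circle q.2)%R)%:E.
have mF2 : measurable_fun setT F2.
  apply/measurable_EFinP; apply: measurable_funM.
  - exact: (measurableT_comp mf measurable_fst).
  - exact: (measurableT_comp mchi msub).
have F20 q : 0 <= F2 q by rewrite lee_fin mulr_ge0.
have -> : \int[@plane_measure R]_z ((chi z)%:E * \int[@circle_prob R]_x
      (f ((z : R[i]) + (2 * r)%:C%C * unit_circle x)%R)%:E) =
    \int[@plane_measure R]_z \int[@circle_prob R]_x F1 (z, x).
  apply: eq_integral => z _; rewrite -ge0_integralZl//.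
  - apply/measurable_EFinP; apply: (measurableT_comp mf).
    exact: (measurableT_comp (measurable_addC_circle s) (pair1_measurable (z : borelC R))).
  - by move=> x _; rewrite lee_fin.
  - by rewrite lee_fin.
rewrite (fubini_tonelli (m1 := @plane_measure R) (m2 := @circle_prob R) F1 mF1 F10).
have -> : \int[@circle_prob R]_x \int[@plane_measure R]_z F1 (z, x) =
    \int[@circle_prob R]_x \int[@plane_measure R]_z F2 (z, x).
  apply: eq_integral => x _.
  rewrite -[RHS](@plane_integral_shift _ (s%:C%C * unit_circle x)%R).
  - by apply: eq_integral => z _; rewrite /F1 /F2/= addrK mulrC.
  - exact: (measurableT_comp mF2 (pair2_measurable (x : measurableTypeR R))).
  - by move=> z; exact: F20.
rewrite -(fubini_tonelli (m1 := @plane_measure R) (m2 := @circle_prob R) F2 mF2 F20).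
have -> : (4 * C * r ^+ 2 * area)%:E = \int[@plane_measure R]_z
    ((C * s ^+ 2)%:E * (\1_(disc (0%R : R[i]) (S + 1)) z)%:E).
  rewrite ge0_integralZl//; last 2 first.
  - by apply/measurable_EFinP; apply: measurable_indic; exact: measurable_disc.
  - by rewrite lee_fin mulr_ge0// sqr_ge0.
  rewrite integral_indic ?setIT//; last exact: measurable_disc.
  by rewrite [X in _ * X]areaE -EFinM; congr EFin; rewrite /s; ring.
rewrite -ge0_integralD//; last 4 first.
- by move=> z _; rewrite lee_fin.
- by apply/measurable_EFinP; exact: mchif.
- by move=> z _; rewrite mule_ge0// lee_fin// mulr_ge0// sqr_ge0.
- apply: measurable_funeM; apply/measurable_EFinP; apply: measurable_indic.
  exact: measurable_disc.
apply: ge0_le_integral => //.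
- by move=> z _; apply: integral_ge0 => x _; exact: F20.
- exact: (measurable_fun_fubini_tonelli_F (m2 := @circle_prob R) F2 mF2 F20).
- apply: emeasurable_funD; first by apply/measurable_EFinP; exact: mchif.
  apply: measurable_funeM; apply/measurable_EFinP; apply: measurable_indic.
  exact: measurable_disc.
move=> z _; rewrite /F2/=.
have [chi_z|] := pselect (forall x, chi ((z : R[i]) - s%:C%C * unit_circle x)%R = 0%R).
  under eq_integral do rewrite chi_z mulr0.
  rewrite circle_integral_cst adde_ge0 ?mule_ge0 ?lee_fin//.
  by rewrite mulr_ge0// sqr_ge0.
move=> /existsNP[x0 /eqP chi_x0].
have dz : (modulus ((z : R[i]) - s%:C%C * unit_circle x0 - z) <= 2 * r)%R.
  by rewrite addrAC subrr sub0r modulusN modulusM modulusC modulus_circle mulr1 gtr0_norm.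
have fz1 := exp_reg_le1 r0 r3 k0 chi_x0 dz.
have zS : (disc (0%R : R[i]) (S + 1)) z.
  have [zS _] := chi_supp chi_x0; rewrite /disc/= sub0r modulusN.
  have := modulus_triangle ((z : R[i]) - s%:C%C * unit_circle x0)%R z 0%R.
  rewrite !subr0 modulusB; move: dz zS; set a := modulus (_ - _ - _); set b := modulus (_ - _).
  by lra.
rewrite indicE mem_set// mule1.
under eq_integral do rewrite EFinM.
rewrite ge0_integralZl//; last 3 first.
- apply/measurable_EFinP.
  exact: (measurableT_comp mchi (measurableT_comp msub (pair1_measurable (z : borelC R)))).
- by move=> x _; rewrite lee_fin.
- by rewrite lee_fin.
apply: (@le_trans _ _ ((f z)%:E * (chi z + C * s ^+ 2)%:E)).
  by rewrite lee_wpmul2l ?lee_fin//; exact: chi_mean.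
rewrite -EFinM -EFinD lee_fin mulrDr /chif mulrC lerD2l.
by rewrite ler_piMl// mulr_ge0// sqr_ge0.
Qed.

(** Integrate [exp_reg_potential_mean] against chi and apply [mean_transfer]: the
integral of chi exp(k w) is finite and cancels, and k can be divided out. *)
Lemma smeared_le r k : (0 < r)%R -> (3 * r < eta)%R -> (2 * r <= 1)%R -> (0 < k)%R ->
  \int[nu]_t smeared r k t <=
  \int[mu]_t smeared r k t + (4 * C * r ^+ 2 * area / k)%:E.
Proof.
move=> r0 r3 r2 k0; have k0' := ltW k0.
pose A : \bar R := \int[@plane_measure R]_z (chif r k z)%:E.
have A0 : 0 <= A by apply: integral_ge0 => z _; rewrite lee_fin.
have Afin : A \is a fin_num.
  rewrite ge0_fin_numE//.
  apply: (@le_lt_trans _ _ (\int[@plane_measure R]_z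
      (\1_(disc (0%R : R[i]) (S + 1)) z)%:E)).
    apply: ge0_le_integral => //.
    - by move=> z _; rewrite lee_fin.
    - by apply/measurable_EFinP; exact: mchif.
    - by apply/measurable_EFinP; apply: measurable_indic; exact: measurable_disc.
    - move=> z _; rewrite lee_fin; have [cz|cz] := eqVneq (chi z) 0%R.
        by rewrite /chif cz mul0r.
      have [zS _] := chi_supp cz; rewrite indicE mem_set; first exact: chif1.
      by rewrite /disc/= sub0r modulusN; lra.
  rewrite integral_indic ?setIT//; last exact: measurable_disc.
  exact: plane_measure_disc_lty.
have mexp : measurable_fun setT (fun q : borelC R * measurableTypeR R =>
    (exp_reg mu nu r c k ((q.1 : R[i]) + (2 * r)%:C%C * unit_circle q.2)%R)%:E).
  apply/measurable_EFinP.
  exact: (measurableT_comp (measurable_exp_reg mu nu c k r0) (measurable_addC_circle _)).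
have mI : measurable_fun setT (fun z : borelC R => \int[@circle_prob R]_x
    (exp_reg mu nu r c k ((z : R[i]) + (2 * r)%:C%C * unit_circle x)%R)%:E).
  apply: (measurable_fun_fubini_tonelli_F (m2 := @circle_prob R) _ mexp).
  by move=> q; rewrite lee_fin expR_ge0.
have mD sigma : measurable_fun setT
    (fun z : borelC R => (k * chif r k z)%:E * deficit_mass sigma r (z : R[i])).
  apply: emeasurable_funM; last exact: measurable_deficit_mass.
  by apply/measurable_EFinP; apply: measurable_funM => //; exact: mchif.
have D0 sigma z : 0 <= (k * chif r k z)%:E * deficit_mass sigma r z.
  by rewrite mule_ge0 ?deficit_mass_ge0// lee_fin mulr_ge0.
have I0 z : 0 <= (chi z)%:E * \int[@circle_prob R]_x
    (exp_reg mu nu r c k (z + (2 * r)%:C%C * unit_circle x)%R)%:E.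
  rewrite mule_ge0 ?lee_fin//; apply: integral_ge0 => x _.
  by rewrite lee_fin expR_ge0.
have : \int[@plane_measure R]_z ((chif r k z)%:E +
      (k * chif r k z)%:E * deficit_mass nu r z) <=
    \int[@plane_measure R]_z ((chi z)%:E * \int[@circle_prob R]_x
      (exp_reg mu nu r c k ((z : R[i]) + (2 * r)%:C%C * unit_circle x)%R)%:E
      + (k * chif r k z)%:E * deficit_mass mu r z).
  apply: ge0_le_integral => //.
  - by move=> z _; rewrite adde_ge0// lee_fin.
  - by apply: emeasurable_funD => //; apply/measurable_EFinP; exact: mchif.
  - apply: emeasurable_funD => //; apply: emeasurable_funM => //.
    exact/measurable_EFinP.
  - move=> z _.
    have := exp_reg_potential_mean c z mu_log nu_log r0 k0'.
    have chiz0 : 0 <= (chi z)%:E by rewrite lee_fin.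
    move=> /(lee_wpmul2l chiz0).
    have kchi : (k * chif r k z)%:E = (chi z)%:E * (k * exp_reg mu nu r c k z)%:E.
      by rewrite -EFinM; congr EFin; rewrite /chif; ring.
    have w0 sigma : 0 <= (k * exp_reg mu nu r c k z)%:E * deficit_mass sigma r z.
      by rewrite mule_ge0 ?deficit_mass_ge0// lee_fin mulr_ge0// expR_ge0.
    have J0 : 0 <= \int[@circle_prob R]_x
        (exp_reg mu nu r c k ((z : R[i]) + (2 * r)%:C%C * unit_circle x)%R)%:E.
      by apply: integral_ge0 => x _; rewrite lee_fin expR_ge0.
    have e0 : 0 <= (exp_reg mu nu r c k z)%:E by rewrite lee_fin expR_ge0.
    rewrite (ge0_muleDr _ e0 (w0 nu)) (ge0_muleDr _ J0 (w0 mu)).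
    by rewrite !muleA -!kchi -EFinM.
rewrite ge0_integralD//; last 2 first.
- by move=> z _; rewrite lee_fin.
- by apply/measurable_EFinP; exact: mchif.
rewrite ge0_integralD//; last first.
  by apply: emeasurable_funM => //; exact/measurable_EFinP.
rewrite !integral_smeared// -/A => h.
have {h} := le_trans h (leeD2r _ (mean_transfer r0 r3 r2 k0')).
rewrite -/A; set X := \int[nu]_t _; set Y := \int[mu]_t _.
have X0 : 0 <= X by apply: integral_ge0 => t _; exact: smeared_ge0.
have Y0 : 0 <= Y by apply: integral_ge0 => t _; exact: smeared_ge0.
clearbody A X Y; case: A Afin {A0} => [a| |]// _.
case: Y Y0 => [y| |]// _; last by rewrite addye// leey.
case: X X0 => [x| |]// _; last by rewrite gt0_muley ?lte_fin.
rewrite !lee_fin => h; rewrite -(ler_pM2l k0) mulrDr mulrCA divff ?gt_eqF// mulr1.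
by lra.
Qed.

Let mdeficit_shift r t : (0 < r)%R ->
  measurable_fun setT (fun z : borelC R => (deficit r ((z : R[i]) - t))%:E).
Proof.
move=> r0; apply/measurable_EFinP.
exact: (measurableT_comp (measurable_deficit r0) (measurable_shiftC (- t)%R)).
Qed.

Let mchif_deficit r k t : (0 < r)%R ->
  measurable_fun setT (fun z : borelC R => (chif r k z * deficit r ((z : R[i]) - t))%:E).
Proof.
move=> r0; apply/measurable_EFinP; apply: measurable_funM; first exact: mchif.
by have /measurable_EFinP := mdeficit_shift t r0.
Qed.

Lemma smeared_close r k t (a e : R) : (0 < r)%R -> (0 <= a)%R -> (0 <= e)%R ->
  (forall z, (modulus (t - z) < 3 * r)%R -> (`|chif r k z - a| <= e)%R) ->
  smeared r k t <= (a + e)%:E * deficit_total r /\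
  a%:E * deficit_total r <= smeared r k t + e%:E * deficit_total r.
Proof.
move=> r0 a0 e0 close.
have near z : (chif r k z * deficit r (z - t) <= (a + e) * deficit r (z - t) /\
    a * deficit r (z - t) <= chif r k z * deficit r (z - t) + e * deficit r (z - t))%R.
  have [zt|zt] := leP (3 * r)%R (modulus (z - t)).
    by rewrite deficit_far// !mulr0 addr0.
  have d0 : (0 <= deficit r (z - t))%R by exact: deficit_ge0.
  have := close z; rewrite modulusB => /(_ zt); rewrite ler_norml => /andP[h1 h2].
  by rewrite -mulrDl; split; rewrite ler_wpM2r//; lra.
rewrite -(deficit_total_shift t r0); split.
- rewrite -ge0_integralZl//; last 3 first.
  + exact: mdeficit_shift.
  + by move=> z _; rewrite lee_fin deficit_ge0.
  + by rewrite lee_fin addr_ge0.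
  apply: ge0_le_integral => //.
  + by move=> z _; exact: (smear0 k (z, (t : borelC R)) r0).
  + exact: mchif_deficit.
  + by apply: measurable_funeM; exact: mdeficit_shift.
  + by move=> z _; rewrite -EFinM lee_fin; case: (near z).
- rewrite -!ge0_integralZl//; try by [exact: mdeficit_shift|
    move=> z _; rewrite lee_fin deficit_ge0|rewrite lee_fin].
  rewrite /smeared -ge0_integralD//; last 4 first.
  + by move=> z _; exact: (smear0 k (z, (t : borelC R)) r0).
  + exact: mchif_deficit.
  + by move=> z _; rewrite mule_ge0// lee_fin// deficit_ge0.
  + by apply: measurable_funeM; exact: mdeficit_shift.
  apply: ge0_le_integral => //.
  + by move=> z _; rewrite mule_ge0// lee_fin// deficit_ge0.
  + by apply: measurable_funeM; exact: mdeficit_shift.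
  + apply: emeasurable_funD; first exact: mchif_deficit.
    by apply: measurable_funeM; exact: mdeficit_shift.
  + by move=> z _; rewrite -!EFinM -EFinD lee_fin; case: (near z).
Qed.

(** The value of chi exp(k w) at t, seen through an approximate identity. *)
Definition averaged r k (t : borelC R) : R :=
  (fine (smeared r k t) / fine (deficit_total r))%R.

Let total_gt0 r : (0 < r)%R -> (0 < fine (deficit_total r))%R.
Proof.
move=> r0; rewrite -lte_fin fineK ?deficit_total_fin//.
apply: lt_le_trans (deficit_total_ge r0); rewrite lte_fin mulr_gt0//.
- by rewrite ln_gt0// ltr1n.
- by rewrite exprn_gt0// divr_gt0.
Qed.

Lemma smeared_le_total r k t : (0 < r)%R -> (3 * r < eta)%R -> (0 <= k)%R ->
  smeared r k t <= deficit_total r.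
Proof.
move=> r0 r3 k0; rewrite -(deficit_total_shift t r0); apply: ge0_le_integral => //.
- by move=> z _; exact: (smear0 k (z, (t : borelC R)) r0).
- exact: mchif_deficit.
- exact: mdeficit_shift.
- by move=> z _; rewrite lee_fin ler_piMl ?deficit_ge0//; exact: chif1.
Qed.

Let smeared_fin r k t : (0 < r)%R -> (3 * r < eta)%R -> (0 <= k)%R ->
  smeared r k t \is a fin_num.
Proof.
move=> r0 r3 k0; rewrite ge0_fin_numE ?smeared_ge0//.
by apply: le_lt_trans (smeared_le_total t r0 r3 k0) _; rewrite ltey_eq deficit_total_fin.
Qed.

Lemma averaged01 r k t : (0 < r)%R -> (3 * r < eta)%R -> (0 <= k)%R ->
  (0 <= averaged r k t <= 1)%R.
Proof.
move=> r0 r3 k0; rewrite divr_ge0 ?fine_ge0 ?smeared_ge0 ?deficit_total_ge0//=.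
rewrite ler_pdivrMr ?total_gt0// mul1r fine_le ?smeared_fin ?deficit_total_fin//.
exact: smeared_le_total.
Qed.

Lemma measurable_averaged r k : (0 < r)%R -> measurable_fun setT (averaged r k).
Proof.
move=> r0; apply: measurable_funM => //.
exact: (measurableT_comp (fine_measurable measurableT) (measurable_smeared k r0)).
Qed.

Lemma averaged_close r k t (a e : R) : (0 < r)%R -> (3 * r < eta)%R -> (0 <= k)%R ->
  (0 <= a)%R -> (0 <= e)%R ->
  (forall z, (modulus (t - z) < 3 * r)%R -> (`|chif r k z - a| <= e)%R) ->
  (`|averaged r k t - a| <= e)%R.
Proof.
move=> r0 r3 k0 a0 e0 close; have m0 := total_gt0 r0.
have [] := smeared_close r0 a0 e0 close.
rewrite -(fineK (smeared_fin t r0 r3 k0)) -(fineK (deficit_total_fin r0)).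
rewrite -!EFinM -EFinD !lee_fin => h1 h2.
rewrite ler_norml; apply/andP; split; rewrite /averaged.
- rewrite lerNl opprB lerBlDr -(ler_pM2r m0) mulrDl divfK ?gt_eqF//.
  by lra.
- by rewrite lerBlDr ler_pdivrMr//; lra.
Qed.

(* 64 = 4 * 4^2, where 4 comes from the radius 2 r of the circles and 4^2 from the
   lower bound on the total deficit. *)
Let bound : R := (64 * C * area / ln 2)%R.

Lemma averaged_le r k : (0 < r)%R -> (3 * r < eta)%R -> (2 * r <= 1)%R -> (0 < k)%R ->
  \int[nu]_t (averaged r k t)%:E <= \int[mu]_t (averaged r k t)%:E + (bound / k)%:E.
Proof.
move=> r0 r3 r2 k0; have m0 := total_gt0 r0; have k0' := ltW k0.
set m := fine (deficit_total r) in m0.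
have area0 : (0 <= area)%R by rewrite fine_ge0.
have avgE (sigma : {finite_measure set (borelC R) -> \bar R}) :
    \int[sigma]_t (averaged r k t)%:E = (m^-1)%:E * \int[sigma]_t smeared r k t.
  rewrite -ge0_integralZl//.
  - apply: eq_integral => t _; rewrite /averaged EFinM fineK ?smeared_fin//.
    by rewrite muleC.
  - exact: measurable_smeared.
  - by move=> t _; exact: smeared_ge0.
  - by rewrite lee_fin invr_ge0 ltW.
rewrite !avgE.
have mV0 : 0 <= (m^-1)%:E by rewrite lee_fin invr_ge0 ltW.
have := lee_wpmul2l mV0 (smeared_le r0 r3 r2 k0).
have e0 : (0 <= 4 * C * r ^+ 2 * area / k)%R.
  by have r0' := ltW r0; rewrite divr_ge0// !mulr_ge0// exprn_ge0.
have s0 : 0 <= \int[mu]_t smeared r k t by apply: integral_ge0 => t _; exact: smeared_ge0.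
have e0' : 0 <= (4 * C * r ^+ 2 * area / k)%:E by rewrite lee_fin.
rewrite (ge0_muleDr _ s0 e0').
move/le_trans; apply; rewrite leeD2l// -EFinM lee_fin.
have l2 : (0 < ln 2 :> R)%R by rewrite ln_gt0// ltr1n.
have mge : (ln 2 * (r / 4) ^+ 2 <= m)%R.
  by rewrite -lee_fin fineK ?deficit_total_fin// deficit_total_ge.
rewrite mulrA [(m^-1 * _)%R]mulrC ler_pM2r ?invr_gt0//.
rewrite ler_pdivrMr// /bound [leRHS]mulrAC ler_pdivlMr//.
have : (64 * C * area * (ln 2 * (r / 4) ^+ 2) <= 64 * C * area * m)%R.
  by rewrite ler_wpM2l// !mulr_ge0.
by rewrite expr_div_n; lra.
Qed.

Let w t : R := (fine (log_potential mu t) - fine (log_potential nu t) - c)%R.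

Definition limit_weight k (t : borelC R) : R := (chi t * expR (k * w t))%R.

Lemma limit_weight_ge0 k t : (0 <= limit_weight k t)%R.
Proof. by rewrite mulr_ge0// expR_ge0. Qed.

(** Either chi vanishes near t, or the potentials are finite at t and
[reg_potential_cvg] controls the whole disc of radius 3 r over which the average is
taken. *)
Lemma averaged_cvg k t (e : R) : (0 < e)%R -> (0 <= k)%R ->
  exists2 delta : R, (0 < delta)%R & forall r, (0 < r < delta)%R -> (3 * r < eta)%R ->
    (`|averaged r k t - limit_weight k t| <= e)%R.
Proof.
move=> e0 k0; have [Ot|nOt] := pselect (Omega t); last first.
  have chi_t z : (modulus (t - z) < eta)%R -> chi z = 0%R.
    move=> tz; apply: contrapT => /eqP /chi_supp[_ +]; rewrite modulusB in tz.
    by move=> /(_ t tz).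
  exists eta => // r /andP[r0 _] r3; apply: averaged_close => //.
  - exact: limit_weight_ge0.
  - exact: ltW.
  - move=> z tz; rewrite /chif /limit_weight !chi_t ?subrr ?modulus0//.
      by rewrite !mul0r subrr normr0 ltW.
    exact: lt_trans r3.
have e20 : (0 < e / 2)%R by rewrite divr_gt0.
have /cvgrPdist_lt/(_ _ e20) := @continuous_expR R (k * w t)%R.
move=> [d1 /= d10 expd1].
pose d1' := (d1 / (4 * (k + 1)))%R.
have k10 : (0 < k + 1)%R by rewrite ltr_wpDl.
have d1'0 : (0 < d1')%R by rewrite divr_gt0// mulr_gt0.
have [dm dm0 Hm] := reg_potential_cvg mu_log (mu_fin Ot) d1'0.
have [dn dn0 Hn] := reg_potential_cvg nu_log (nu_fin Ot) d1'0.
have d20 : (0 < e / (2 * expR (k * w t)))%R by rewrite divr_gt0// mulr_gt0// expR_gt0.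
have [dc dc0 Hc] := chi_cont t d20.
exists (Num.min (Num.min dm dn) (dc / 3))%R.
  by rewrite !lt_min dm0 dn0 divr_gt0.
move=> r /andP[r0]; rewrite !lt_min => /andP[/andP[rm rn] rc] r3.
apply: averaged_close => //; [exact: limit_weight_ge0|exact: ltW|move=> z tz].
have {}Hm := Hm r _ z tz; rewrite r0 rm in Hm; have {Hm}/ler_normlP[hm1 hm2] := Hm isT.
have {}Hn := Hn r _ z tz; rewrite r0 rn in Hn; have {Hn}/ler_normlP[hn1 hn2] := Hn isT.
have hc : (`|chi z - chi t| <= e / (2 * expR (k * w t)))%R.
  by apply: Hc; apply: lt_le_trans tz _; rewrite ltr_pdivlMr// in rc; lra.
pose y := (reg_potential mu r z - reg_potential nu r z - c)%R.
have yw : (`|k * w t - k * y| < d1)%R.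
  rewrite -mulrBr normrM (ger0_norm k0).
  have yw' : (`|w t - y| <= 2 * d1')%R.
    by rewrite /w /y ler_norml; apply/andP; split; lra.
  apply: le_lt_trans (_ : k * (2 * d1') < _)%R; first by rewrite ler_wpM2l.
  have -> : (k * (2 * d1') = (k / (k + 1)) * (d1 / 2))%R.
    by rewrite /d1'; field; rewrite gt_eqF.
  have : (k / (k + 1) <= 1)%R by rewrite ler_pdivrMr// mul1r lerDl.
  have d120 : (0 <= d1 / 2)%R by rewrite divr_ge0// ltW.
  by move=> /(ler_wpM2r d120); lra.
have he : (`|expR (k * y) - expR (k * w t)| < e / 2)%R.
  by rewrite distrC; apply: expd1.
have -> : (chif r k z - limit_weight k t =
    chi z * (expR (k * y) - expR (k * w t)) + (chi z - chi t) * expR (k * w t))%R.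
  by rewrite /chif /limit_weight /exp_reg -/y; ring.
apply: le_trans (ler_normD _ _) _; rewrite !normrM (ger0_norm (chi0 z)).
rewrite (ger0_norm (expR_ge0 _)) [leRHS]splitr; apply: lerD.
  by rewrite -[leRHS]mul1r ler_pM// ltW.
rewrite -ler_pdivlMr ?expR_gt0//; apply: le_trans hc _.
by rewrite invfM mulrA.
Qed.

(* A sequence tending to 0 along which 3 r < eta and 2 r <= 1. *)
Let radius (n : nat) : R := (Num.min (eta / 4) 2^-1 * harmonic n)%R.

Let radius_gt0 n : (0 < radius n)%R.
Proof. by rewrite mulr_gt0 ?harmonic_gt0// lt_min !(divr_gt0, invr_gt0)/=. Qed.

Let harmonic_le1 n : (@harmonic R n <= 1)%R.
Proof. by rewrite invf_le1// ler1n. Qed.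

Let radius3 n : (3 * radius n < eta)%R.
Proof.
have h : (Num.min (eta / 4) 2^-1 <= eta / 4)%R by rewrite ge_min lexx.
have : (radius n <= eta / 4 * 1)%R.
  by rewrite ler_pM ?harmonic_ge0// le_min divr_ge0//= ltW.
by have := eta0; lra.
Qed.

Let radius2 n : (2 * radius n <= 1)%R.
Proof.
have h : (Num.min (eta / 4) 2^-1 <= 2^-1)%R by rewrite ge_min lexx orbT.
have : (radius n <= 2^-1 * 1)%R.
  by rewrite ler_pM ?harmonic_ge0// le_min divr_ge0//= ltW.
by lra.
Qed.

Let radius_cvg : radius n @[n --> \oo] --> 0%R.
Proof.
rewrite -[X in _ --> X](mulr0 (Num.min (eta / 4) 2^-1)%R).
by apply: cvgM; [exact: cvg_cst|exact: cvg_harmonic].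
Qed.

Let averaged_limit k t : (0 <= k)%R -> averaged (radius n) k t @[n --> \oo] --> limit_weight k t.
Proof.
move=> k0; apply/cvgrPdist_le => e e0.
have [delta delta0 Hd] := averaged_cvg t e0 k0.
near=> n; rewrite distrC; apply: Hd => //; rewrite radius_gt0/=.
by near: n; exact: (cvgr_lt 0%R).
Unshelve. all: end_near. Qed.

Lemma limit_weight_le k : (0 < k)%R ->
  [/\ measurable_fun setT (limit_weight k), forall t, (0 <= limit_weight k t <= 1)%R &
    \int[nu]_t (limit_weight k t)%:E <=
    \int[mu]_t (limit_weight k t)%:E + (bound / k)%:E].
Proof.
move=> k0; have k0' := ltW k0; split.
- apply: (@measurable_fun_cvg _ _ _ _ (fun n => averaged (radius n) k)).
  + by move=> n; exact: (measurable_averaged k (radius_gt0 n)).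
  + by move=> t _; exact: averaged_limit.
- move=> t; rewrite limit_weight_ge0/=.
  have h := @averaged_limit k t k0'; rewrite -(cvg_lim (@Rhausdorff R) h).
  apply: limr_le; first by apply/cvg_ex; exists (limit_weight k t).
  by apply: nearW => n; case/andP: (averaged01 t (radius_gt0 n) (radius3 n) k0').
- apply: (@bounded_cvg_integral_le _ _ _ mu nu (fun n => averaged (radius n) k)
    _ (fun=> (bound / k)%R)).
  + by move=> n; exact: (measurable_averaged k (radius_gt0 n)).
  + by move=> n t; exact: averaged01.
  + by move=> t; exact: averaged_limit.
  + exact: cvg_cst.
  + by move=> n; exact: averaged_le.
Qed.

Let contact : set (borelC R) :=
  [set z : borelC R | Omega z /\ log_potential mu z = log_potential nu z + c%:E].

(** As k grows, exp(k w) decreases to the indicator function of the set w = 0. *)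
Lemma test_function_le :
  \int[nu]_t (chi t * \1_contact t)%:E <= \int[mu]_t (chi t * \1_contact t)%:E.
Proof.
rewrite -[leRHS]adde0.
apply: (@bounded_cvg_integral_le _ _ _ mu nu (fun n => limit_weight n.+1%:R)
    _ (fun n => (bound / n.+1%:R)%R)).
- by move=> n; have [] := @limit_weight_le n.+1%:R (ltr0Sn _ _).
- by move=> n t; have [_ +] := @limit_weight_le n.+1%:R (ltr0Sn _ _).
- move=> t; rewrite /limit_weight.
  have [Ot|nOt] := pselect (Omega t); last first.
    have -> : chi t = 0%R.
      by apply: contrapT => /eqP/chi_supp[_] /(_ t); rewrite subrr modulus0 => /(_ eta0).
    by under eq_fun do rewrite mul0r; rewrite mul0r; exact: cvg_cst.
  apply: cvgM; first exact: cvg_cst.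
  have := le_pot Ot; rewrite -(fineK (mu_fin Ot)) -(fineK (nu_fin Ot)) -EFinD lee_fin.
  rewrite le_eqVlt => /predU1P[wt|wt].
    have tA : t \in contact.
      rewrite inE; split => //.
      by rewrite -(fineK (mu_fin Ot)) -(fineK (nu_fin Ot)) -EFinD wt.
    rewrite indicE tA; apply: cvg_near_cst; apply: nearW => n.
    by rewrite /w wt addrAC addrK subrr mulr0 expR0.
  have tA : t \notin contact.
    rewrite notin_setE => -[_]; rewrite -(fineK (mu_fin Ot)) -(fineK (nu_fin Ot)) -EFinD.
    by case=> wt'; rewrite wt' ltxx in wt.
  rewrite indicE (negbTE tA).
  under eq_fun do rewrite expRM_natl.
  have : (expR (w t) ^+ n)%R @[n --> \oo] --> 0%R; last first.
    by move=> h; have := h; rewrite -cvg_shiftS.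
  apply: cvg_expr; rewrite ger0_norm ?expR_ge0// -[ltRHS](@expR0 R) ltr_expR /w.
  by lra.
- rewrite -[X in _ --> X](mulr0 bound); apply: cvgM; first exact: cvg_cst.
  exact: cvg_harmonic.
- by move=> n; have [_ _] := @limit_weight_le n.+1%:R (ltr0Sn _ _).
Qed.

End TestFunction.

(** * Cutoff functions of an open set *)

Section Cutoff.
Context {R : realType}.
Variables (U : set R[i]) (n : nat).
Implicit Types (r : R) (z w p : R[i]).
Local Notation N := (n.+1%:R : R).

(** The points where the n-th cutoff has to vanish. The points of large modulus make
this set nonempty even if U is the whole plane, and the cutoff compactly
supported. *)
Definition far p : Prop :=
  (N <= modulus p)%R \/ exists2 q, ~ U q & (modulus (p - q) <= N^-1)%R.

Definition bump p z : R := Num.min 1%R (N * modulus (z - p) ^+ 2)%R.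

(** An infimum of functions with Laplacian at most 4 N inherits the one-sided bound,
whatever the set of parameters: this is why the squares of the distances are used
rather than the distances. *)
Definition cutoff z : R := inf [set bump p z | p in far].

Let N0 : (0 < N)%R. Proof. exact: ltr0Sn. Qed.
Let N1 : (1 <= N)%R. Proof. by rewrite ler1n. Qed.

Let bump_ge0 p z : (0 <= bump p z)%R.
Proof. by rewrite le_min ler01 mulr_ge0 ?sqr_ge0. Qed.

Let bump_le1 p z : (bump p z <= 1)%R.
Proof. by rewrite ge_min lexx. Qed.

Lemma cutoff_le p z : far p -> (cutoff z <= bump p z)%R.
Proof.
by move=> Fp; apply: ge_inf; [exists 0%R => _ [q _ <-]|exists p].
Qed.

Lemma cutoff_ge z (a : R) : (forall p, far p -> a <= bump p z)%R -> (a <= cutoff z)%R.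
Proof.
move=> h; apply: lb_le_inf; last by move=> _ [p Fp <-]; exact: h.
exists (bump N%:C%C z), (N%:C%C) => //.
by left; rewrite modulusC ger0_norm// ltW.
Qed.

Lemma cutoff01 z : (0 <= cutoff z <= 1)%R.
Proof.
apply/andP; split; first by apply: cutoff_ge.
apply: le_trans (bump_le1 N%:C%C z); apply: cutoff_le.
by left; rewrite modulusC ger0_norm// ltW.
Qed.

(* The squared distance is Lipschitz where it is at most 1 / N <= 1; there and for
   |z - w| < 1 its increment is at most 2 |w - p| |z - w| + |z - w|^2 <= 3 |z - w|. *)
Let bump_lipschitz p z w : (bump p z <= bump p w + 3 * N * modulus (z - w))%R.
Proof.
have [h|h] := leP 1%R (N * modulus (w - p) ^+ 2)%R.
  rewrite [X in (_ <= X + _)%R]/bump (min_l h); apply: le_trans (bump_le1 _ _) _.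
  by rewrite lerDl mulr_ge0 ?modulus_ge0// mulr_ge0// ltW.
rewrite [X in (_ <= X + _)%R]/bump (min_r (ltW h)).
have [zw|zw] := leP 1%R (modulus (z - w)).
  apply: le_trans (bump_le1 _ _) _.
  have : (0 <= N * modulus (w - p) ^+ 2)%R by rewrite mulr_ge0 ?sqr_ge0// ltW.
  have : (1 * 1 <= N * modulus (z - w))%R by rewrite ler_pM.
  by lra.
rewrite ge_min; apply/orP; right.
have := modulus_triangle w z p.
have := modulus_ge0 (z - w)%R; have := modulus_ge0 (w - p)%R; have := modulus_ge0 (z - p)%R.
move: zw h; set d := modulus (z - w); set a := modulus (z - p); set b := modulus (w - p).
move=> d1 Nb a0 b0 d0 abd.
have b1 : (b <= 1)%R.
  rewrite -(@expr_le1 _ 2)//; apply: le_trans (ltW Nb).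
  by rewrite ler_peMl// sqr_ge0.
have h2 : (a ^+ 2 <= (d + b) ^+ 2)%R by rewrite lerXn2r// nnegrE addr_ge0.
have h3 : (d * d <= d * 1)%R by rewrite ler_wpM2l// ltW.
have h4 : (d * b <= d * 1)%R by rewrite ler_wpM2l.
have : (a ^+ 2 <= b ^+ 2 + 3 * d)%R by lra.
by move=> /(ler_wpM2l (ltW N0)); rewrite mulrDr; lra.
Qed.

Lemma cutoff_lipschitz z w : (`|cutoff z - cutoff w| <= 3 * N * modulus (z - w))%R.
Proof.
have half x y : (cutoff x <= cutoff y + 3 * N * modulus (x - y))%R.
  rewrite -lerBlDr; apply: cutoff_ge => p Fp; rewrite lerBlDr.
  exact: le_trans (cutoff_le _ Fp) (bump_lipschitz _ _ _).
have := half z w; have := half w z; rewrite [modulus (w - z)]modulusB => h1 h2.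
by rewrite ler_norml; apply/andP; split; lra.
Qed.

Lemma measurable_cutoff : measurable_fun setT (cutoff : borelC R -> R).
Proof. exact: lipschitz_measurable cutoff_lipschitz. Qed.

(** The mean of an infimum is at most the infimum of the means, and the mean of
N |. - p|^2 exceeds its value by N r^2 exactly ([circle_mean_sqr]). *)
Lemma cutoff_circle_mean z r :
  \int[@circle_prob R]_x (cutoff (z - r%:C%C * unit_circle x)%R)%:E <=
  (cutoff z + N * r ^+ 2)%:E.
Proof.
have mc : measurable_fun setT
    (fun x : R => (z - r%:C%C * unit_circle x : borelC R)%R).
  under eq_fun do rewrite -mulNr -rmorphN.
  exact: (measurableT_comp (measurable_addC_circle (- r)%R)
    (pair1_measurable (z : borelC R))).
have mf : measurable_fun setT (fun x : R => (cutoff (z - r%:C%C * unit_circle x)%R)%:E).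
  by apply/measurable_EFinP; exact: (measurableT_comp measurable_cutoff mc).
have f0 x : 0 <= (cutoff (z - r%:C%C * unit_circle x)%R)%:E.
  by rewrite lee_fin; case/andP: (cutoff01 (z - r%:C%C * unit_circle x)%R).
set I := \int[_]_x _.
have I0 : 0 <= I by exact: integral_ge0.
have I1 : I <= 1.
  rewrite -[leRHS](@circle_integral_cst R 1); apply: ge0_le_integral => //.
  - move=> x _; rewrite lee_fin.
    by case/andP: (cutoff01 (z - r%:C%C * unit_circle x)%R).
have Ip p : far p -> I <= (bump p z + N * r ^+ 2)%:E.
  move=> Fp; have [h|h] := leP 1%R (N * modulus (z - p) ^+ 2)%R.
    rewrite /bump (min_l h); apply: le_trans I1 _; rewrite lee_fin lerDl.
    by rewrite mulr_ge0 ?sqr_ge0// ltW.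
  rewrite /bump (min_r (ltW h)) -mulrDr EFinM -circle_mean_sqr.
  have mg : measurable_fun setT
      (fun x : R => (modulus (z - p - r%:C%C * unit_circle x)%R ^+ 2)%:E).
    apply/measurable_EFinP; apply: measurable_funX.
    under eq_fun do rewrite -mulNr -rmorphN.
    exact: measurable_shifted_circle.
  rewrite -ge0_integralZl//.
  - apply: ge0_le_integral => //.
    + exact: measurable_funeM.
    + move=> x _; rewrite -EFinM lee_fin; apply: le_trans (cutoff_le _ Fp) _.
      by rewrite ge_min; apply/orP; right; rewrite addrAC.
  - by move=> x _; rewrite lee_fin sqr_ge0.
move: I0 I1 Ip; case: I => [i| |]// _ _ Ip.
rewrite lee_fin -lerBlDr; apply: cutoff_ge => p Fp.
by rewrite lerBlDr -lee_fin; exact: Ip.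
Qed.

Lemma cutoff_far z : far z -> cutoff z = 0%R.
Proof.
move=> Fz; have := cutoff_le z Fz; have /andP[c0 _] := cutoff01 z.
rewrite /bump subrr modulus0 expr0n mulr0 (min_r ler01) => c1.
by apply/eqP; rewrite eq_le c1.
Qed.

Lemma cutoff_support z : cutoff z != 0%R -> (modulus z < N)%R /\
  forall w, (modulus (z - w) < N^-1)%R -> U w.
Proof.
move=> cz; have Fz : ~ far z by move=> /cutoff_far zE; rewrite zE eqxx in cz.
split; first by rewrite ltNge; apply/negP => h; apply: Fz; left.
move=> w zw; apply: contrapT => Uw; apply: Fz; right; exists w => //.
exact: ltW.
Qed.

End Cutoff.

(** If the disc of radius d about z lies in U, the points that are far for a large n
are at distance at least d / 2 from z, and then N (d / 2)^2 >= 1. *)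
Lemma cutoff_cvg {R : realType} (U : set R[i]^o) (z : R[i]) : open U ->
  cutoff U n z @[n --> \oo] --> (\1_U z : R).
Proof.
move=> oU; rewrite indicE; have [Uz|nUz] := boolP (z \in U); last first.
  apply: cvg_near_cst; apply: nearW => n; apply: cutoff_far; right; exists z.
    by move: nUz; rewrite notin_setE.
  by rewrite subrr modulus0 invr_ge0.
rewrite inE in Uz; have [d d0 dU] := (open_modulusP U).1 oU z Uz.
apply: cvg_near_cst; near=> n.
have nz : (modulus z + 1 <= n.+1%:R)%R.
  rewrite (@le_trans _ _ n%:R) ?ler_nat//; near: n; exact: nbhs_infty_ger.
have nd : (2 / d <= n.+1%:R)%R.
  rewrite (@le_trans _ _ n%:R) ?ler_nat//; near: n; exact: nbhs_infty_ger.
have nd2 : (4 / d ^+ 2 <= n.+1%:R)%R.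
  rewrite (@le_trans _ _ n%:R) ?ler_nat//; near: n; exact: nbhs_infty_ger.
have N0 : (0 < n.+1%:R :> R)%R by exact: ltr0Sn.
apply/eqP; rewrite eq_le; have /andP[_ ->] /= := cutoff01 U n z.
apply: cutoff_ge => p Fp; rewrite /bump le_min lexx /=.
case: Fp => [pn|[q nUq pq]].
  have zp : (1 <= modulus (z - p))%R.
    by have := le_modulusB p z; rewrite [modulus (p - z)]modulusB; lra.
  rewrite -[leLHS]mulr1 ler_pM ?ler1n//.
  exact: exprn_ege1.
have zq : (d <= modulus (z - q))%R.
  by rewrite leNgt; apply/negP => zq; exact/nUq/dU.
have Nd : (n.+1%:R^-1 <= d / 2)%R.
  by rewrite -[leRHS]invrK lef_pV2 ?posrE// ?invr_gt0 ?divr_gt0// invf_div.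
have zp : (d / 2 <= modulus (z - p))%R.
  by have := modulus_triangle p z q; have := le_trans pq Nd; lra.
have h : ((d / 2) ^+ 2 <= modulus (z - p) ^+ 2)%R.
  by rewrite lerXn2r// nnegrE ?modulus_ge0// divr_ge0// ltW.
have d41 : (4 / d ^+ 2 * (d / 2) ^+ 2 = 1)%R by field; rewrite gt_eqF.
rewrite -[leLHS]d41.
by rewrite ler_pM// ?divr_ge0// ?sqr_ge0.
Unshelve. all: end_near. Qed.

(** * Regularity of finite Borel measures *)

Section Regularity.
Context {R : realType}.
Variable sigma : {finite_measure set (borelC R) -> \bar R}.
Local Notation plane := (set (borelC R)).

(** Stated with an open neighbourhood of the complement instead of a closed
subset, regularity is invariant under complementation. *)
Definition regular (B : plane) : Prop := forall e : R, (0 < e)%R ->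
  exists V W : set R[i]^o, [/\ open V, open W, B `<=` V, ~` B `<=` W &
    sigma (V `&` W) <= e%:E].

Let sigma_lty (B : plane) : measurable B -> sigma B < +oo.
Proof. by move=> mB; rewrite ltey_eq fin_num_measure. Qed.

Let eventually_small (F : nat -> plane) (a e : R) : (forall n, measurable (F n)) ->
  (forall n, F n.+1 `<=` F n) -> sigma (\bigcap_n F n) <= a%:E -> (a < e)%R ->
  exists n, sigma (F n) <= e%:E.
Proof.
move=> mF dF Fa ae.
have mI : measurable (\bigcap_n F n) by exact: bigcapT_measurable.
have cF : sigma (F n) @[n --> \oo] --> sigma (\bigcap_n F n).
  apply: nonincreasing_cvg_mu => //; first exact: sigma_lty.
  by apply/nonincreasing_seqP => n; apply/subsetPset; exact: dF.
have : \forall n \near \oo, sigma (F n) < e%:E.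
  have h : sigma (\bigcap_n F n) < e%:E by rewrite (le_lt_trans Fa)// lte_fin.
  exact: (cF _ (open_ereal_lt' h)).
by move=> [n _ /(_ n (leqnn n)) /ltW h]; exists n.
Qed.

(** The complement of U is the decreasing intersection of its neighbourhoods. *)
Lemma regular_open (U : set R[i]^o) : open U -> regular (U : plane).
Proof.
move=> oU e e0.
pose W (n : nat) : set R[i]^o :=
  [set p | exists2 q : R[i], ~ U q & (modulus ((p : R[i]) - q) < n.+1%:R^-1)%R].
have oW n : open (W n).
  apply/open_modulusP => p [q nUq pq]; exists (n.+1%:R^-1 - modulus ((p : R[i]) - q))%R.
    by rewrite subr_gt0.
  move=> w pw; exists q => //; apply: le_lt_trans (modulus_triangle p w q) _.
  by rewrite modulusB -ltrBrDr.
have [n Hn] : exists n, sigma (U `&` W n) <= e%:E.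
  apply: (@eventually_small (fun n => U `&` W n) 0%R) => //.
  - by move=> n; apply: measurableI; exact: open_measurableC.
  - move=> n; apply: setIS => p [q nUq pq]; exists q => //; apply: lt_trans pq _.
    by rewrite ltf_pV2 ?posrE// ltr_nat.
  - rewrite (_ : \bigcap_n _ = set0) ?measure0// -subset0 => z Uz.
    have [d d0 dU] := (open_modulusP U).1 oU z (Uz 0%N I).1.
    have [_ [q nUq zq]] := Uz (Num.bound d^-1) I.
    apply/nUq/dU; apply: lt_trans zq _.
    rewrite -[ltRHS]invrK ltf_pV2 ?posrE ?invr_gt0//.
    apply: lt_le_trans (archi_boundP _) _; first by rewrite invr_ge0 ltW.
    by rewrite ler_nat.
exists U, (W n); split => // z nUz; exists z => //.
by rewrite subrr modulus0 invr_gt0.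
Qed.

Lemma regular_setC (B : plane) : regular B -> regular (~` B).
Proof.
move=> rB e /rB[V [W [oV oW BV BW VW]]].
by exists W, V; split => //; rewrite ?setCK// setIC.
Qed.

(** The complement of the union is an infinite intersection, which need not have an
open neighbourhood of the form of the intersection of the W n; by continuity from
above finitely many of them are enough, at the price of half of the error. *)
Lemma regular_bigcup (B : nat -> plane) : (forall n, regular (B n)) ->
  regular (\bigcup_n B n).
Proof.
move=> rB e e0.
have e20 : (0 < e / 2)%R by rewrite divr_gt0.
have en0 n : (0 < e / 2 / (2 ^ n.+1)%:R)%R by rewrite divr_gt0// ltr0n expn_gt0.
have /choice[V /choice[W VW]] := fun n => rB n _ (en0 n).
pose WW n : set R[i]^o := \bigcap_(i < n) W i.
have oWW n : open (WW n).
  rewrite /WW bigcap_mkord; elim: n => [|n ih]; first by rewrite big_ord0; exact: openT.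
  by rewrite big_ord_recr; apply: openI => //; case: (VW n).
have oV : open (\bigcup_n V n) by apply: bigcup_open => n _; case: (VW n).
have [n Hn] : exists n, sigma ((\bigcup_n V n) `&` WW n) <= e%:E.
  apply: (@eventually_small (fun n => (\bigcup_n V n) `&` WW n) (e / 2)%R) => //.
  - by move=> n; apply: measurableI; exact: open_measurableC.
  - by move=> n; apply: setIS => z Wz i/= ltin; apply: Wz => /=; exact: ltnW.
  - apply: le_trans (epsilon_trick0 xpredT (ltW e20)).
    apply: (@le_trans _ _ (\sum_(0 <= i <oo) sigma (V i `&` W i))).
      apply: measure_sigma_subadditive.
      + by move=> i; case: (VW i) => ? ? _ _ _; apply: measurableI; exact: open_measurableC.
      + apply: bigcapT_measurable => i; apply: measurableI; exact: open_measurableC.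
      + move=> z Fz; have [[i _ Viz] _] := Fz 0%N I.
        by exists i => //; split => //; have [_] := Fz i.+1 I; apply => /=.
    by apply: lee_nneseries => // i _; case: (VW i).
  - by lra.
exists (\bigcup_n V n), (WW n); split => //.
- by apply: subset_bigcup => i _; case: (VW i).
- rewrite setC_bigcup => z Bz i _; case: (VW i) => _ _ _ + _; apply.
  exact: Bz.
Qed.

Lemma measurable_regular (B : plane) : measurable B -> regular B.
Proof.
move: B; apply: (@smallest_sub _ _ _ [set B | regular B]); last by move=> U; exact: regular_open.
split.
- by apply: regular_open; exact: open0.
- by move=> C rC; rewrite setTD; exact: regular_setC.
- exact: regular_bigcup.
Qed.

Lemma outer_regular (B : plane) (e : R) : measurable B -> (0 < e)%R ->
  exists V : set R[i]^o, [/\ open V, B `<=` V & sigma V <= sigma B + e%:E].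
Proof.
move=> mB e0; have [V [W [oV oW BV BW VW]]] := measurable_regular mB e0.
exists V; split => //; apply: le_trans (leeD2l _ VW).
have mV := open_measurableC oV; have mW := open_measurableC oW.
apply: (@le_trans _ _ (sigma (B `|` (V `&` W)))).
  apply: le_measure; rewrite ?inE//; first by apply: measurableU => //; exact: measurableI.
  by move=> z Vz; have [Bz|/BW Wz] := pselect (B z); [left|right].
by apply: measureU2 => //; exact: measurableI.
Qed.

End Regularity.

(** * The contact set *)

Section Contact.
Context {R : realType}.
Variables mu nu : {finite_measure set (borelC R) -> \bar R}.
Hypothesis mu_log : integrates_log_at_infinity mu.
Hypothesis nu_log : integrates_log_at_infinity nu.
Variable Omega : set R[i]^o.
Hypothesis Omega_open : open Omega.
Hypothesis mu_fin : forall z, Omega z -> log_potential mu z \is a fin_num.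
Hypothesis nu_fin : forall z, Omega z -> log_potential nu z \is a fin_num.
Variable c : R.
Hypothesis le_pot : forall z, Omega z -> log_potential mu z <= log_potential nu z + c%:E.

Let contact : set (borelC R) :=
  [set z : borelC R | Omega z /\ log_potential mu z = log_potential nu z + c%:E].

Lemma measurable_contact : measurable contact.
Proof.
have [f mf fE] := measurable_potential_on mu_log.
have [g mg gE] := measurable_potential_on nu_log.
have -> : contact = Omega `&` (setT `&` [set z | f z = g z + c%:E]).
  rewrite setTI; apply/seteqP; split => z [Oz eqz]; split => //.
    by rewrite /= -fE ?mu_fin// -gE ?nu_fin.
  by rewrite fE ?mu_fin// gE ?nu_fin.
apply: measurableI; first exact: open_measurableC.
by apply: measurable_eqe => //; apply: emeasurable_funD.
Qed.

Lemma contact_le_open (U : set R[i]^o) : open U -> U `<=` Omega ->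
  nu ((U : set (borelC R)) `&` contact) <= mu ((U : set (borelC R)) `&` contact).
Proof.
move=> oU UO; have mU := open_measurableC oU; have mC := measurable_contact.
pose g n (z : borelC R) : R := (cutoff U n z * \1_contact z)%R.
have mg n : measurable_fun setT (g n).
  by apply: measurable_funM; [exact: measurable_cutoff|exact: measurable_indic].
have integralE (sigma : {finite_measure set (borelC R) -> \bar R}) :
    \int[sigma]_z (\1_(U `&` contact : set (borelC R)) z)%:E = sigma (U `&` contact).
  by rewrite integral_indic ?setIT//; exact: measurableI.
rewrite -!integralE -[leRHS]adde0.
apply: (@bounded_cvg_integral_le _ _ _ mu nu g _ (fun=> 0%R)) => //.
- move=> n z; have /andP[c0 c1] := cutoff01 U n z.
  have i0 : (0 <= (\1_contact z : R) <= 1)%R by rewrite indicE; case: (_ \in _); rewrite !(lexx, ler01).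
  by case/andP: i0 => i0 i1; rewrite mulr_ge0//= -[leRHS]mulr1 ler_pM.
- move=> z; rewrite indicI; apply: cvgM; last exact: cvg_cst.
  exact: cutoff_cvg.
- exact: cvg_cst.
- move=> n; rewrite adde0; apply: (@test_function_le _ mu nu mu_log nu_log Omega
    mu_fin nu_fin c le_pot (cutoff U n) n.+1%:R n.+1%:R^-1 n.+1%:R) => //.
  + exact: measurable_cutoff.
  + exact: cutoff01.
  + by move=> z r _; exact: cutoff_circle_mean.
  + move=> z /cutoff_support[zn zU]; split => // w zw; exact/UO/zU.
  + move=> t e e0; exists (e / (3 * n.+1%:R))%R; first by rewrite divr_gt0// mulr_gt0.
    move=> z; rewrite ltr_pdivlMr ?mulr_gt0// mulrC modulusB => /ltW.
    exact/le_trans/cutoff_lipschitz.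
Qed.

(** The contact set lies in Omega, so that an outer approximation of B & contact for
mu may be cut down to an open subset of Omega. *)
Lemma contact_le (B : set (borelC R)) : measurable B ->
  nu (B `&` contact) <= mu (B `&` contact).
Proof.
move=> mB; have mC := measurable_contact; have mBC := measurableI _ _ mB mC.
apply/lee_addgt0Pr => e e0.
have [V [oV BV Ve]] := outer_regular mu mBC e0.
have oVO : open (V `&` Omega) by exact: openI.
have mVO := open_measurableC oVO; have mV := open_measurableC oV.
apply: (@le_trans _ _ (nu ((V `&` Omega) `&` contact))).
  apply: le_measure; rewrite ?inE//; first exact: measurableI.
  by move=> z BCz; have [_ Cz] := BCz; split => //; split; [exact: BV|case: Cz].
apply: le_trans (contact_le_open oVO (@subIsetr _ _ _)) _.
apply: le_trans Ve; apply: le_measure; rewrite ?inE//; first exact: measurableI.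
by move=> z [[]].
Qed.

End Contact.

Theorem theorem4p9 (R : realType)
  (mu nu : {finite_measure set (borelC R) -> \bar R})
  (mu_log : integrates_log_at_infinity mu)
  (nu_log : integrates_log_at_infinity nu)
  (supp_neqT : measure_support mu `|` measure_support nu <> setT)
  (Omega : set R[i]^o) (Omega_domain : domain Omega)
  (mu_fin : forall z, Omega z -> log_potential mu z \is a fin_num)
  (nu_fin : forall z, Omega z -> log_potential nu z \is a fin_num)
  (c : R)
  (le_pot : forall z, Omega z -> log_potential mu z <= log_potential nu z + c%:E)
  (A : set (borelC R))
  (A_def : A = [set z : borelC R |
     Omega z /\ log_potential mu z = log_potential nu z + c%:E]) :
  exists mA : measurable A,
    forall B : set (borelC R), measurable B ->
      mrestr nu mA B <= mrestr mu mA B.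
Proof.
have [oO _ _] := Omega_domain.
have mA : measurable A by rewrite A_def; exact: measurable_contact.
exists mA => B mB; rewrite /mrestr A_def.
exact: (contact_le mu_log nu_log oO mu_fin nu_fin le_pot mB).
Qed.
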